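(* Let $\mathcal{H}=\ell^2(\mathbb{N},\mathbb{C})$. For $1\le p<\infty$, the topological group $U_p(\mathcal{H})$ neither has property (FH) nor has property (T).
   Context: $\mathcal{B}_p(\mathcal{H})$ is the $p$-th Schatten ideal, and $U_p(\mathcal{H})=U(\mathcal{H})\cap(\mathbf{1}+\mathcal{B}_p(\mathcal{H}))$ carries the topology induced by the metric $(g,h)\mapsto\|g-h\|_p$ (Schatten norm). Continuous unitary (resp. orthogonal) representations $(\pi,\mathcal{K})$ are strongly continuous homomorphisms of $G$ into the unitary (resp. orthogonal) group of a complex (resp. real) Hilbert space $\mathcal{K}$. A 1-cocycle is a map $\beta:G\to\mathcal{K}$ with $\beta(gh)=\beta(g)+\pi(g)\beta(h)$ for all $g,h\in G$; it is a 1-coboundary if $\beta(g)=\pi(g)v-v$ for all $g\in G$, for some $v\in\mathcal{K}$. $H^1(G,\pi,\mathcal{K})$ is the space of continuous 1-cocycles modulo the 1-coboundaries. Property (FH): $H^1(G,\pi,\mathcal{K})=\{0\}$ for every continuous orthogonal representation $(\pi,\mathcal{K})$ of $G$. Property (T): there exist a compact subset $K\subseteq G$ and $\varepsilon>0$ such that every continuous unitary representation $(\pi,\mathcal{K})$ of $G$ for which there is a unit vector $v\in\mathcal{K}$ with $\sup_{g\in K}\|\pi(g)v-v\|<\varepsilon$ has a nonzero $G$-fixed vector. *)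

(* Defs.v *)
From HB Require Import structures.
From mathcomp Require Import all_boot all_order all_algebra sesquilinear.
From mathcomp Require Import all_classical all_reals all_analysis.
From mathcomp Require Import complex ring lra.

Set Implicit Arguments.
Unset Strict Implicit.
Unset Printing Implicit Defensive.

Import Order.TTheory GRing.Theory Num.Theory Num.Def.
Import numFieldNormedType.Exports.

Local Open Scope classical_set_scope.
Local Open Scope ring_scope.

(* [theta] is [idfun] for real Hilbert spaces and [conjC] for complex ones.
   The inner product is linear in its first argument. *)
Record hilbert (K : numFieldType) (theta : K -> K) := Hilbert {
  hilbert_sort :> completeNormedModType K ;
  hdot : {dot hilbert_sort for theta} ;
  hnormE : forall x : hilbert_sort, `|x| ^+ 2 = hdot x x }.

Notation real_hilbert R := (@hilbert R idfun).
Notation complex_hilbert R := (@hilbert R[i] (@conjC _)).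

(* Orthogonal operators when [K] is the field of reals. *)
Record unitary (K : numFieldType) (theta : K -> K) (H : hilbert theta) := Unitary {
  unitary_fun :> H -> H ;
  unitary_linear : linear unitary_fun ;
  unitary_dot : forall x y, hdot H (unitary_fun x) (unitary_fun y) = hdot H x y ;
  unitary_surj : forall y, exists x, unitary_fun x = y }.

Section UnitaryGroup.
Context (K : numFieldType) (theta : K -> K) (H : hilbert theta).
Implicit Types u v w : unitary H.

Lemma unitary_ext u v : (u : H -> H) =1 v -> u = v.
Proof.
case: u v => u1 u2 u3 u4 [v1 v2 v3 v4] /= /funext uv; subst v1.
by congr Unitary; exact: Prop_irrelevance.
Qed.

Lemma unitary_inj u : injective u.
Proof.
move=> x y uxy; apply/eqP; rewrite -subr_eq0 -normr_eq0 -sqrf_eq0 hnormE.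
have uxy0 : u (x - y) = 0.
  have := unitary_linear u (-1) y x; rewrite !scaleN1r uxy addNr.
  by rewrite [- y + x]addrC.
by rewrite -(unitary_dot u) uxy0 -hnormE normr0 expr0n.
Qed.

Fact unitary_id_surj (y : H) : exists x, idfun x = y. Proof. by exists y. Qed.
Definition unitary_one : unitary H :=
  @Unitary _ _ H idfun (fun _ _ _ => erefl) (fun _ _ => erefl) unitary_id_surj.

Fact unitary_comp_linear u v : linear (u \o v).
Proof. by move=> a x y /=; rewrite !unitary_linear. Qed.
Fact unitary_comp_dot u v x y : hdot H ((u \o v) x) ((u \o v) y) = hdot H x y.
Proof. by rewrite /= !unitary_dot. Qed.
Fact unitary_comp_surj u v z : exists x, (u \o v) x = z.
Proof.
have [y <-] := unitary_surj u z; have [x <-] := unitary_surj v y.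
by exists x.
Qed.
Definition unitary_mul u v : unitary H :=
  Unitary (unitary_comp_linear u v) (unitary_comp_dot u v)
    (unitary_comp_surj u v).

Definition unitary_invf u (y : H) : H := sval (cid (unitary_surj u y)).
Fact unitary_invfK u y : u (unitary_invf u y) = y.
Proof. exact: (proj2_sig (cid (unitary_surj u y))). Qed.
Fact unitary_invf_linear u : linear (unitary_invf u).
Proof.
by move=> a x y; apply: (@unitary_inj u); rewrite unitary_linear !unitary_invfK.
Qed.
Fact unitary_invf_dot u x y :
  hdot H (unitary_invf u x) (unitary_invf u y) = hdot H x y.
Proof. by rewrite -(unitary_dot u) !unitary_invfK. Qed.
Fact unitary_invf_surj u x : exists y, unitary_invf u y = x.
Proof.
by exists (u x); apply: (@unitary_inj u); rewrite unitary_invfK.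
Qed.
Definition unitary_inv u : unitary H :=
  Unitary (unitary_invf_linear u) (unitary_invf_dot u) (unitary_invf_surj u).

HB.instance Definition _ := gen_eqMixin (unitary H).
HB.instance Definition _ := gen_choiceMixin (unitary H).

Let mulA : associative unitary_mul.
Proof. by move=> u v w; apply: unitary_ext. Qed.
Let mul1 : left_id unitary_one unitary_mul.
Proof. by move=> u; apply: unitary_ext. Qed.
Let mulr1 : right_id unitary_one unitary_mul.
Proof. by move=> u; apply: unitary_ext. Qed.
Let mulV : left_inverse unitary_one unitary_inv unitary_mul.
Proof.
move=> u; apply: unitary_ext => x; apply: (@unitary_inj u).
exact: (unitary_invfK u (u x)).
Qed.
Let mulrV : right_inverse unitary_one unitary_inv unitary_mul.
Proof. by move=> u; apply: unitary_ext => x; exact: (unitary_invfK u x). Qed.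

HB.instance Definition _ :=
  isGroup.Build (unitary H) mulA mul1 mulr1 mulV mulrV.

End UnitaryGroup.

Section Ell2.
Context {R : realType}.
Local Notation C := R[i].
Implicit Types (x y : nat -> C) (u v : nat -> R).

Definition normsq (z : C) : R := complex.Re z ^+ 2 + complex.Im z ^+ 2.

Definition square_summable : {pred nat -> C} :=
  [pred x : nat -> C | `[< cvgn (series (fun n => normsq (x n))) >]].

Lemma square_summableP x :
  reflect (cvgn (series (fun n => normsq (x n)))) (x \in square_summable).
Proof. exact: asboolP. Qed.

Lemma normsq_ge0 z : 0 <= normsq z.
Proof. by rewrite addr_ge0 ?sqr_ge0. Qed.

Lemma normsqE z : (normsq z)%:C%C = z * z^*.
Proof. by rewrite add_Re2_Im2 normCK. Qed.

Lemma conjCc (z : C) : z^* = conjc z.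
Proof.
have [->|z0] := eqVneq z 0; first by rewrite !rmorph0.
by apply: (mulfI z0); rewrite -normsqE add_Re2_Im2 sqr_normc.
Qed.

Let cvg_dominated u v : (forall n, `|u n| <= v n) -> cvgn (series v) ->
  cvgn (series u).
Proof.
move=> uv cv; apply: normed_cvg; apply: series_le_cvg (uv) cv => n //.
exact: le_trans (uv n).
Qed.

Let cvg_comb (b : R) u v k l : series u @ \oo --> k -> series v @ \oo --> l ->
  series (fun n => b * u n + v n) @ \oo --> b * k + l.
Proof.
move=> uk vl.
rewrite (_ : series _ = fun n => b * series u n + series v n); last first.
  by apply/funext => n; rewrite /series/= big_split/= mulr_sumr.
by apply: cvgD => //; apply: cvgM => //; exact: cvg_cst.
Qed.

Lemma square_summable_submod : submod_closed square_summable.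
Proof.
split.
  apply/square_summableP; rewrite (_ : series _ = cst 0); first exact: is_cvg_cst.
  by apply/funext => n; rewrite /series /= big1// => i _; rewrite /normsq/= expr0n addr0.
move=> a x y /square_summableP sx /square_summableP sy; apply/square_summableP.
apply: (@cvg_dominated _ (fun n => 2 * normsq a * normsq (x n) +
    (2 * normsq (y n) + 0))); last first.
  apply/cvg_ex; eexists; apply: cvg_comb sx _; apply: (cvg_comb sy).
  rewrite (_ : series _ = cst 0); first exact: cvg_cst.
  by apply/funext => n; rewrite /series/= big1.
move=> n; rewrite ger0_norm ?normsq_ge0//.
rewrite -[(_ + _) n]/(a * x n + y n).
rewrite /normsq/=; case: a (x n) (y n) => [a b] [c d] [e f] /=.
rewrite -subr_ge0.
set t := (X in 0 <= X).
have -> : t = (a * c - b * d - e) ^+ 2 + (a * d + b * c - f) ^+ 2.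
  by rewrite /t; ring.
by rewrite addr_ge0 ?sqr_ge0.
Qed.
HB.instance Definition _ :=
  GRing.isSubmodClosed.Build C (nat -> C) square_summable square_summable_submod.

Record ell2 := Ell2 { ell2_seq :> nat -> C ; _ : ell2_seq \in square_summable }.

HB.instance Definition _ := [isSub for ell2_seq].
HB.instance Definition _ := [Choice of ell2 by <:].
HB.instance Definition _ := [SubChoice_isSubLmodule of ell2 by <:].

Implicit Types f g : ell2.

Lemma ell2P f : cvgn (series (fun n => normsq (f n))).
Proof. by case: f => x /= /square_summableP. Qed.

Definition csum (x : nat -> C) : C :=
  Complex (limn (series (fun n => complex.Re (x n))))
          (limn (series (fun n => complex.Im (x n)))).

Definition csummable (x : nat -> C) :=
  cvgn (series (fun n => complex.Re (x n))) /\
  cvgn (series (fun n => complex.Im (x n))).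

Lemma csumP a x y : csummable x -> csummable y ->
  csum (fun n => a * x n + y n) = a * csum x + csum y.
Proof.
move=> [xr xi] [yr yi].
have lim_comb (b c : R) u v w : cvgn (series u) -> cvgn (series v) ->
    cvgn (series w) ->
    limn (series (fun n => b * u n + c * v n + w n)) =
    b * limn (series u) + c * limn (series v) + limn (series w).
  move=> cu cv cw.
  rewrite (_ : (fun n => _) = fun n => b * u n + (c * v n + w n)).
    by rewrite -addrA; apply: cvg_lim => //; apply: cvg_comb => //; exact: cvg_comb.
  by apply/funext => n; rewrite addrA.
rewrite /csum; case: a => a b; apply/eqP; rewrite eq_complex/=; apply/andP; split.
- rewrite -mulNr -lim_comb//; apply/eqP; congr (limn (series _)).
  by apply/funext => n; case: (x n) (y n) => ? ? [? ?] /=; rewrite mulNr.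
- rewrite -lim_comb//; apply/eqP; congr (limn (series _)).
  by apply/funext => n; case: (x n) (y n) => ? ? [? ?].
Qed.

Lemma csum_conj x : csummable x -> csum (fun n => (x n)^*) = (csum x)^*.
Proof.
move=> [xr xi]; rewrite conjCc /csum /=; congr Complex.
  by congr (limn (series _)); apply/funext => n; rewrite conjCc; case: (x n).
rewrite -lim_seriesN//; congr (limn (series _)); apply/funext => n.
by rewrite conjCc -[(- _) n]/(- _); case: (x n).
Qed.

Definition ell2_dot f g : C := csum (fun n => f n * (g n)^*).

Lemma ell2_csummable f g : csummable (fun n => f n * (g n)^*).
Proof.
have fg := is_cvg_seriesD (@ell2P f) (@ell2P g).
split; apply: cvg_dominated fg => n; rewrite conjCc -[(_ + _) n]/(_ + _);
  case: (f n) (g n) => [a b] [c d]; rewrite /normsq/= ler_norml.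
- have := (sqr_ge0 (a + c), sqr_ge0 (b + d), sqr_ge0 (a - c), sqr_ge0 (b - d)).
  have := (sqr_ge0 a, sqr_ge0 b, sqr_ge0 c, sqr_ge0 d); rewrite !sqrrB !sqrrD.
  by move=> [[[? ?] ?] ?] [[[? ?] ?] ?]; apply/andP; split; lra.
- have := (sqr_ge0 (a + d), sqr_ge0 (b + c), sqr_ge0 (a - d), sqr_ge0 (b - c)).
  have := (sqr_ge0 a, sqr_ge0 b, sqr_ge0 c, sqr_ge0 d); rewrite !sqrrB !sqrrD.
  by move=> [[[? ?] ?] ?] [[[? ?] ?] ?]; apply/andP; split; lra.
Qed.

Lemma ell2_dotPl g a f f' :
  ell2_dot (a *: f + f') g = a * ell2_dot f g + ell2_dot f' g.
Proof.
rewrite -csumP; [|exact: ell2_csummable..].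
by congr csum; apply/funext => n; rewrite /= mulrDl mulrA.
Qed.

Lemma ell2_dotC f g : ell2_dot f g = (ell2_dot g f)^*.
Proof.
rewrite -csum_conj; last exact: ell2_csummable.
by congr csum; apply/funext => n; rewrite rmorphM/= conjCK mulrC.
Qed.

Lemma ell2_dotPr f a g g' :
  ell2_dot f (a *: g + g') = a^* * ell2_dot f g + ell2_dot f g'.
Proof.
by rewrite ell2_dotC ell2_dotPl rmorphD rmorphM/= -!ell2_dotC.
Qed.

Definition ell2_sqnorm f : R := limn (series (fun n => normsq (f n))).

Lemma ell2_dotE f : ell2_dot f f = (ell2_sqnorm f)%:C%C.
Proof.
rewrite /ell2_dot /csum /real_complex_def; congr Complex.
  by congr (limn (series _)); apply/funext => n; rewrite -normsqE.
rewrite (_ : series _ = cst 0) ?lim_cst//.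
by apply/funext => n; rewrite /series/= big1// => i _; rewrite -normsqE.
Qed.

Lemma ell2_sqnorm_ge n f : \sum_(0 <= i < n) normsq (f i) <= ell2_sqnorm f.
Proof.
apply: nondecreasing_cvgn_le; last exact: ell2P.
by apply: nondecreasing_series => i _ _; exact: normsq_ge0.
Qed.

Lemma ell2_sqnorm_ge1 n f : normsq (f n) <= ell2_sqnorm f.
Proof.
apply: le_trans (ell2_sqnorm_ge n.+1 f).
by rewrite big_nat_recr//= lerDr sumr_ge0// => i _; exact: normsq_ge0.
Qed.

Lemma ell2_sqnorm_ge0 f : 0 <= ell2_sqnorm f.
Proof. exact: le_trans (normsq_ge0 _) (ell2_sqnorm_ge1 0 f). Qed.

Lemma ell2_sqnorm0 f : ell2_sqnorm f = 0 -> f = 0.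
Proof.
move=> f0; apply/val_inj/funext => n; have := ell2_sqnorm_ge1 n f.
rewrite f0 /normsq/= -[0 n]/(0 : R[i]); move: (f n) => [a b] /= ab.
have : a ^+ 2 + b ^+ 2 == 0 by rewrite eq_le ab addr_ge0 ?sqr_ge0.
by rewrite paddr_eq0 ?sqr_ge0// !sqrf_eq0 => ab0; apply/eqP; rewrite eq_complex /=.
Qed.

Let dot_addl g : zmod_morphism (ell2_dot^~ g).
Proof. by move=> f f'; rewrite -scaleN1r addrC ell2_dotPl mulN1r addrC. Qed.
Let dot_addr f : zmod_morphism (ell2_dot f).
Proof. by move=> g g'; rewrite -scaleN1r addrC ell2_dotPr rmorphN1 mulN1r addrC. Qed.
Let dot0l g : ell2_dot 0 g = 0.
Proof. by rewrite -(subrr 0) dot_addl subrr. Qed.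
Let dot0r g : ell2_dot g 0 = 0.
Proof. by rewrite -(subrr 0) dot_addr subrr. Qed.
Let dot_scalel g : scalable_for *%R (ell2_dot^~ g).
Proof. by move=> a f; rewrite -[_ *: _]addr0 ell2_dotPl dot0l addr0. Qed.
Let dot_scaler f : scalable_for (conjC \; *%R) (ell2_dot f).
Proof. by move=> a g; rewrite -[_ *: _]addr0 ell2_dotPr dot0r addr0. Qed.
Let dot_herm f g : ell2_dot f g = (-1) ^+ false * (ell2_dot g f)^*.
Proof. by rewrite expr0 mul1r -ell2_dotC. Qed.
Let dot_gt0 f : f != 0 -> 0 < ell2_dot f f.
Proof.
move=> f0; rewrite ell2_dotE ltcR lt_neqAle ell2_sqnorm_ge0 andbT.
by apply: contra f0 => /eqP/esym/ell2_sqnorm0 ->.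
Qed.

HB.instance Definition _ := @isBilinear.Build C ell2 ell2 C *%R (conjC \; *%R)
  ell2_dot dot_addl dot_addr dot_scalel dot_scaler.
HB.instance Definition _ := @isHermitianSesquilinear.Build C ell2 false conjC
  ell2_dot dot_herm.
HB.instance Definition _ := @isDotProduct.Build C ell2 ell2_dot dot_gt0.

Definition ell2_norm f : R := Num.sqrt (ell2_sqnorm f).

Lemma ell2_norm_ge0 f : 0 <= ell2_norm f. Proof. exact: sqrtr_ge0. Qed.

Lemma ell2_sqr_norm f : ell2_norm f ^+ 2 = ell2_sqnorm f.
Proof. by rewrite sqr_sqrtr// ell2_sqnorm_ge0. Qed.

Lemma ell2_sqnorm_le f M :
  (forall n, \sum_(0 <= i < n) normsq (f i) <= M) -> ell2_sqnorm f <= M.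
Proof.
move=> fM; apply: limr_le; first exact: ell2P.
by apply: nearW => n; exact: fM.
Qed.

Lemma ell2_norm0 f : ell2_norm f = 0 -> f = 0.
Proof. by move=> f0; apply: ell2_sqnorm0; rewrite -ell2_sqr_norm f0 expr0n. Qed.

Lemma ell2_normZ a f :
  (ell2_norm (a *: f))%:C%C = `|a| * (ell2_norm f)%:C%C.
Proof.
rewrite /ell2_norm; have -> : ell2_sqnorm (a *: f) = normsq a * ell2_sqnorm f.
  apply: complexI; rewrite -ell2_dotE linearZl_LR linearZr_LR/= ell2_dotE.
  by rewrite mulrA -normsqE rmorphM.
by rewrite sqrtrM ?normsq_ge0// normc_def rmorphM.
Qed.

Lemma ell2_normD f g : ell2_norm (f + g) <= ell2_norm f + ell2_norm g.
Proof.
have [/ell2_norm0->|f0] := eqVneq (ell2_norm f) 0.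
  by rewrite add0r lerDr ell2_norm_ge0.
have [/ell2_norm0->|g0] := eqVneq (ell2_norm g) 0.
  by rewrite addr0 lerDl ell2_norm_ge0.
set a := ell2_norm f; set b := ell2_norm g.
have a0 : 0 < a by rewrite lt_neqAle eq_sym f0 ell2_norm_ge0.
have b0 : 0 < b by rewrite lt_neqAle eq_sym g0 ell2_norm_ge0.
have ab0 : 0 <= a + b by rewrite addr_ge0 ?ltW.
rewrite -(@ler_pXn2r _ 2)// ?nnegrE ?ell2_norm_ge0// ell2_sqr_norm.
apply: ell2_sqnorm_le => n.
have ptwise i : normsq ((f + g) i) <=
    (1 + b / a) * normsq (f i) + (1 + a / b) * normsq (g i).
  rewrite -[(f + g) i]/(f i + g i) /normsq.
  case: (f i) (g i) => [c d] [e h] /=; rewrite -subr_ge0.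
  set t := (X in 0 <= X).
  have -> : t = ((b * c - a * e) ^+ 2 + (b * d - a * h) ^+ 2) / (a * b).
    by rewrite /t; field; rewrite !gt_eqF.
  by rewrite divr_ge0 ?addr_ge0 ?sqr_ge0// mulr_ge0 ?ltW.
apply: le_trans (ler_sum _ (fun i _ => ptwise i)) _.
rewrite big_split/= -!mulr_sumr.
have -> : (a + b) ^+ 2 = (1 + b / a) * a ^+ 2 + (1 + a / b) * b ^+ 2.
  by field; rewrite !gt_eqF.
rewrite !ell2_sqr_norm; apply: lerD; apply: ler_wpM2l;
  by rewrite ?ell2_sqnorm_ge// addr_ge0// divr_ge0 ?ltW.
Qed.

Let cnorm f : C := (ell2_norm f)%:C%C.
Let cnormD f g : cnorm (f + g) <= cnorm f + cnorm g.
Proof. by rewrite /cnorm -rmorphD/= lecR ell2_normD. Qed.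
Let cnorm0 f : cnorm f = 0 -> f = 0.
Proof. by move=> /complexI/ell2_norm0. Qed.

HB.instance Definition _ := Lmodule_isNormed.Build C ell2 cnormD ell2_normZ cnorm0.

Lemma ell2_ballE f (e : R) g : ball f e%:C%C g = (ell2_norm (f - g) < e) :> Prop.
Proof. by rewrite -ball_normE /ball_/= ltcR. Qed.

Lemma ell2_complete (F : set_system ell2) : ProperFilter F -> cauchy F -> cvg F.
Proof.
move=> FF /cauchy_ballP F_cauchy.
have F_pair (e : R) : 0 < e ->
    F [set f | F [set g | ell2_norm (f - g) < e]].
  move=> e0; have ec0 : (0 : C) < e%:C%C by rewrite ltcR.
  have [[A B] /= [FA FB] AB] := F_cauchy _ ec0.
  apply: filterS FA => f Af; apply: filterS FB => g Bg.
  by have := AB (f, g) (conj Af Bg); rewrite /= ell2_ballE.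
have coord (p : C -> R) n : (forall z w, `|p z - p w| ^+ 2 <= normsq (z - w)) ->
    cvg (p (f n) @[f --> F]).
  move=> pP; apply: R_complete; apply/cauchy_ballP => e e0.
  have ec0 : (0 : C) < e%:C%C by rewrite ltcR.
  have [[A B] /= [FA FB] AB] := F_cauchy _ ec0.
  exists ([set p (f n) | f in A], [set p (f n) | f in B]) => /=.
    split; [apply: filterS FA | apply: filterS FB];
    by move=> f; exists f.
  move=> [_ _] [/= [f Af <-] [g Bg <-]].
  have := AB (f, g) (conj Af Bg); rewrite /= ell2_ballE -ball_normE /ball_/= => fg.
  apply: le_lt_trans fg; rewrite -(@ler_pXn2r _ 2)// ?nnegrE ?ell2_norm_ge0//.
  by rewrite ell2_sqr_norm; apply: le_trans (ell2_sqnorm_ge1 n (f - g)).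
have cre n : cvg (complex.Re (f n) @[f --> F]).
  by apply: coord => -[a b] [c d]; rewrite real_normK ?num_real// lerDl sqr_ge0.
have cim n : cvg (complex.Im (f n) @[f --> F]).
  by apply: coord => -[a b] [c d]; rewrite real_normK ?num_real// lerDr sqr_ge0.
pose y n : C := Complex (lim (complex.Re (f n) @[f --> F]))
                        (lim (complex.Im (f n) @[f --> F])).
have Fy (e : R) : 0 < e ->
    F [set f | forall n, \sum_(0 <= i < n) normsq (f i - y i) <= e ^+ 2].
  move=> e0; apply: filterS (F_pair _ e0) => f fe n.
  apply: (@cvgr_to_le _ F _ _ (fun g : ell2 => \sum_(0 <= i < n) normsq (f i - g i))).
    elim: n => [|n IHn].
      rewrite big_nil (_ : (fun _ => _) = cst 0); first exact: cvg_cst.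
      by apply/funext => g; rewrite big_nil.
    rewrite big_nat_recr//=.
    rewrite (_ : (fun _ => _) = (fun g : ell2 =>
      \sum_(0 <= i < n) normsq (f i - g i) +
      ((complex.Re (f n) - complex.Re (g n)) *
       (complex.Re (f n) - complex.Re (g n)) +
       (complex.Im (f n) - complex.Im (g n)) *
       (complex.Im (f n) - complex.Im (g n))))); last first.
      apply/funext => g; rewrite big_nat_recr//=; congr (_ + _).
      by rewrite /normsq -!expr2; case: (f n) (g n) => [? ?] [? ?].
    apply: cvgD => //.
    rewrite [normsq _](_ : _ = (complex.Re (f n) - complex.Re (y n)) *
       (complex.Re (f n) - complex.Re (y n)) +
       (complex.Im (f n) - complex.Im (y n)) *
       (complex.Im (f n) - complex.Im (y n))); last first.
      by rewrite /normsq -!expr2 /y; case: (f n).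
    have cR : complex.Re (f n) - complex.Re (g n) @[g --> F] -->
        complex.Re (f n) - complex.Re (y n).
      by apply: cvgB; [exact: cvg_cst|exact: cre].
    have cI : complex.Im (f n) - complex.Im (g n) @[g --> F] -->
        complex.Im (f n) - complex.Im (y n).
      by apply: cvgB; [exact: cvg_cst|exact: cim].
    by apply: cvgD; exact: cvgM.
  apply: filterS fe => g fg; apply: le_trans (ell2_sqnorm_ge n (f - g)) _.
  by rewrite -ell2_sqr_norm ler_pXn2r ?nnegrE ?ell2_norm_ge0 ?ltW.
have [f0 f0y] := filter_ex (Fy 1 ltr01).
have sd : (f0 : nat -> C) - y \in square_summable.
  apply/square_summableP; apply: nondecreasing_is_cvgn.
    by apply: nondecreasing_series => i _ _; exact: normsq_ge0.
  by exists (1 ^+ 2) => _ [n _ <-]; exact: f0y.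
have sy : y \in square_summable.
  have -> : y = (f0 : nat -> C) - ((f0 : nat -> C) - y) by rewrite subKr.
  by rewrite rpredB//; case: f0 {f0y sd}.
apply/cvg_ex; exists (Ell2 sy); apply/fcvg_ballP => e e0.
have [r er] : exists r : R, e = r%:C%C by exists (complex.Re e); rewrite RRe_real ?gtr0_real.
subst e; rewrite ltcR in e0.
have r2 : 0 < r / 2 by rewrite divr_gt0.
apply: filterS (Fy _ r2) => f fy; rewrite ell2_ballE.
apply: (@le_lt_trans _ _ (r / 2)); last by lra.
rewrite -(@ler_pXn2r _ 2)// ?nnegrE ?ell2_norm_ge0 ?(ltW r2)// ell2_sqr_norm.
apply: ell2_sqnorm_le => n; apply: le_trans (fy n); rewrite le_eqVlt.
apply/orP; left; apply/eqP; apply: eq_bigr => i _.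
rewrite -[(Ell2 sy - f) i]/(y i - f i) /normsq.
by case: (f i) (y i) => [a b] [c d] /=; ring.
Qed.

HB.instance Definition _ := Uniform_isComplete.Build ell2 ell2_complete.

Lemma ell2_hnormE f : `|f| ^+ 2 = ell2_dot f f.
Proof. by rewrite ell2_dotE -ell2_sqr_norm rmorphXn. Qed.

Definition ell2_hilbert : complex_hilbert R :=
  @Hilbert C conjC ell2 ell2_dot ell2_hnormE.

End Ell2.
Arguments ell2 : clear implicits.
Arguments ell2_hilbert : clear implicits.

Section Schatten.
Context {R : realType} {H : complex_hilbert R}.
Implicit Types (T : H -> H) (s : nat -> R) (e f : nat -> H).

Definition orthonormal_seq e := forall m n, hdot H (e m) (e n) = (m == n)%:R.

(* [s] is the sequence of singular values of [T], in decreasing order, as read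
   off a Schmidt decomposition [T x = \sum_n s_n <x, e_n> f_n]. When [H] is
   infinite-dimensional, [e] and [f] can be taken infinite for every compact
   [T], with [s_n = 0] from some [n] on if [T] has finite rank. There is
   exactly one such [s] if [T] is linear and compact, and none otherwise. *)
Definition singular_values T : set (nat -> R) :=
  [set s | [/\ forall n, 0 <= s n, nonincreasing_seq s, s n @[n --> \oo] --> (0 : R)
    & exists e f, [/\ orthonormal_seq e, orthonormal_seq f
      & forall x, \sum_(0 <= i < n) ((s i)%:C%C * hdot H x (e i)) *: f i
                    @[n --> \oo] --> T x]]].

(* The infimum ranges over at most one value, and is [+oo] when [T] has no
   singular values; the p-th Schatten ideal is where the norm is finite. *)
Definition schatten_norm (p : R) T : \bar R :=
  ereal_inf [set ((\sum_(0 <= n <oo) (s n `^ p)%:E) `^ p^-1)%E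
            | s in singular_values T].

Definition schatten_ideal (p : R) : set (H -> H) :=
  [set T | (schatten_norm p T < +oo)%E].

End Schatten.

Section SchattenUnitary.
Context {R : realType} (H : complex_hilbert R) (p : R).

Record schatten_unitary := SchattenUnitary {
  schatten_unitary_val :> unitary H ;
  schatten_unitaryP : schatten_ideal p (fun x => schatten_unitary_val x - x) }.

HB.instance Definition _ := gen_eqMixin schatten_unitary.
HB.instance Definition _ := gen_choiceMixin schatten_unitary.

Implicit Types (g h : schatten_unitary) (A B : set schatten_unitary).

Definition schatten_dist g h : \bar R := schatten_norm p (fun x => g x - h x).

Definition schatten_open A :=
  forall g, A g ->
    exists2 r : R, 0 < r & forall h, (schatten_dist g h < r%:E)%E -> A h.

Let schatten_openT : schatten_open setT.
Proof. by move=> g _; exists 1. Qed.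

Let schatten_openI : setI_closed schatten_open.
Proof.
move=> A B oA oB g [/oA[r r0 rA] /oB[t t0 tB]].
exists (Num.min r t); first by rewrite lt_min r0.
by move=> h; rewrite EFin_min lt_min => /andP[gr gt]; split; [exact: rA|exact: tB].
Qed.

Let schatten_open_bigU (I : Type) (A : I -> set schatten_unitary) :
  (forall i, schatten_open (A i)) -> schatten_open (\bigcup_i A i).
Proof.
move=> oA g [i _ /oA[r r0 rA]]; exists r => // h gh.
by exists i => //; exact: rA.
Qed.

HB.instance Definition _ := isOpenTopological.Build schatten_unitary
  schatten_openT schatten_openI schatten_open_bigU.

End SchattenUnitary.

(* A topological group presented as a subgroup, through [incl], of an abstract
   group, with a topology of its own. The range of [incl] is not required to be
   closed under the group operations; when it is, [is_mul] below is the graph of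
   the group law of [group_carrier], so that [is_mul g h gh] reads [gh = g h]. *)
Record embedded_group := EmbeddedGroup {
  group_carrier :> topologicalType ;
  ambient_group : groupType ;
  incl : group_carrier -> ambient_group ;
  incl_inj : injective incl }.

Definition is_mul (G : embedded_group) (g h gh : G) :=
  incl gh = (incl g * incl h)%g.

Lemma schatten_unitary_inj (R : realType) (H : complex_hilbert R) (p : R) :
  injective (@schatten_unitary_val R H p).
Proof.
move=> [u Pu] [v Pv] /= uv; subst v; congr SchattenUnitary; exact: Prop_irrelevance.
Qed.

Definition U_ (R : realType) (p : R) (H : complex_hilbert R) : embedded_group :=
  @EmbeddedGroup (schatten_unitary H p) (unitary H)
    (@schatten_unitary_val R H p) (@schatten_unitary_inj R H p).

Section Representations.
Context (G : embedded_group).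

Section Def.
Context (K : numFieldType) (theta : K -> K) (V : hilbert theta).
Implicit Types (pi : G -> unitary V) (beta : G -> V).

Definition continuous_representation pi :=
  (forall g h gh, is_mul g h gh -> pi gh = (pi g * pi h)%g) /\
  (forall v : V, continuous (fun g => pi g v)).

Definition cocycle pi beta :=
  forall g h gh, is_mul g h gh -> beta gh = beta g + pi g (beta h).

Definition coboundary pi beta :=
  exists v : V, forall g, beta g = pi g v - v.

Definition trivial_H1 pi :=
  forall beta, continuous beta -> cocycle pi beta -> coboundary pi beta.

End Def.

Definition property_FH (R : realType) :=
  forall (V : real_hilbert R) (pi : G -> unitary V),
    continuous_representation pi -> trivial_H1 pi.

Definition property_T (R : realType) :=
  exists (K : set G) (eps : R), [/\ compact K, 0 < eps &
    forall (V : complex_hilbert R) (pi : G -> unitary V),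
      continuous_representation pi ->
      (exists2 v : V, `|v| = 1 &
        (ereal_sup [set (complex.Re `|pi g v - v|)%:E | g in K] < eps%:E)%E) ->
      exists2 w : V, w != 0 & forall g, pi g w = w].

End Representations.

(* Main.v *)
Require Import Defs.
From HB Require Import structures.
From mathcomp Require Import all_boot all_order all_algebra sesquilinear.
From mathcomp Require Import all_classical all_reals all_analysis.
From mathcomp Require Import complex ring lra.
Import Order.TTheory GRing.Theory Num.Theory Num.Def.
Import numFieldNormedType.Exports.
Local Open Scope ring_scope.

(** Both failures come from the same source: every element of the group is a
compact perturbation of the identity, so an orthonormal sequence [b] is
almost fixed far out, and yet the group contains all the reflections
[x - 2 <x, b m> b m], whose only common fixed vector is 0 when [b] is total.

For property (T), the tautological representation on the Hilbert space does
it. For a fixed [g] the compact operator [g - 1] sends [b n] to a null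
sequence. On a compact set of [g] this is uniform, since the Schatten norm
dominates the operator norm: a choice of bad [g n] for each [n] would cluster
at some [q], contradicting the statement for [q]. So some [b n] is
(K, epsilon)-invariant, and the reflections exclude fixed vectors.

For property (FH), let the group act by [x |-> (n |-> g (x n))] on the
square-summable sequences [x] of vectors of H, seen as a real Hilbert space;
these sequences are the Hilbert-Schmidt operators [X], with [x n = X (b n)],
and the action is left multiplication. Let [A] be the diagonal operator
[A (b n) = (n+1)^(-1/2) b n], which belongs to every Schatten class of exponent
[q > 2] but is not Hilbert-Schmidt. The cocycle is [g |-> (g - 1) A], the
formal coboundary of a vector outside the space. It takes values in the
space and is Lipschitz because Hoelder's inequality bounds [|| T A ||_2] by a
constant times [|| T ||_p]; this is [schatten_norm_harmonic], obtained from
[schatten_norm_weighted]. If it were the coboundary of [V], the reflections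
would force [<V (b m), b m> = (m+1)^(-1/2)] for all [m], and the divergence of the
harmonic series contradicts [V] being Hilbert-Schmidt. *)

Set Implicit Arguments.
Unset Strict Implicit.
Unset Printing Implicit Defensive.
Local Open Scope classical_set_scope.

(** * Real geometry of a complex Hilbert space *)

Section HilbertGeometry.
Context {R : realType} {H : complex_hilbert R}.
Local Notation C := R[i].
Implicit Types (x y z : H) (u : unitary H).

(** The inner product of the underlying real Hilbert space; [nsq] is the squared
norm as a real number, while [hdot] and the norm take values in [R[i]]. *)
Definition rdot x y : R := complex.Re (hdot H x y).
Definition nsq x : R := rdot x x.

Lemma hdotC x y : hdot H x y = (hdot H y x)^*.
Proof. by rewrite -[RHS]mul1r -[1 in RHS](expr0 (-1)); exact: hermC. Qed.

Lemma hdotE x : hdot H x x = (nsq x)%:C%C.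
Proof.
rewrite /nsq /rdot; have := hdotC x x; rewrite conjCc.
by case: (hdot H x x) => a b /= [] b0; congr Complex; lra.
Qed.

Lemma hdotDl x y z : hdot H (x + y) z = hdot H x z + hdot H y z.
Proof. exact: linearDl. Qed.
Lemma hdotBl x y z : hdot H (x - y) z = hdot H x z - hdot H y z.
Proof. exact: linearBl. Qed.
Lemma hdotBr x y z : hdot H x (y - z) = hdot H x y - hdot H x z.
Proof. exact: linearBr. Qed.
Lemma hdotZl a x y : hdot H (a *: x) y = a * hdot H x y.
Proof. exact: linearZl_LR. Qed.
Lemma hdotZr a x y : hdot H x (a *: y) = a^* * hdot H x y.
Proof. exact: linearZr_LR. Qed.

Lemma hdotNN x y : hdot H (- x) (- y) = hdot H x y.
Proof.
have Nl : hdot H (- x) (- y) = - hdot H x (- y) by exact: linearNl.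
have Nr : hdot H x (- y) = - hdot H x y by exact: linearNr.
by rewrite Nl Nr opprK.
Qed.

Lemma nsq_ge0 x : 0 <= nsq x.
Proof. by rewrite -lecR -hdotE -hnormE exprn_ge0. Qed.

Lemma nsq0_eq0 x : nsq x = 0 -> x = 0.
Proof.
move=> x0; apply/eqP; rewrite -normr_eq0 -sqrf_eq0 hnormE hdotE x0.
by rewrite rmorph0.
Qed.

(** Norms of complex Hilbert spaces live in [R[i]]; this moves estimates on
them to [R]. *)
Lemma hilbert_normE x : `|x| = (Num.sqrt (nsq x))%:C%C.
Proof.
apply/eqP; rewrite -(@eqrXn2 _ 2) ?lecR ?sqrtr_ge0//.
by rewrite hnormE hdotE -rmorphXn/= sqr_sqrtr ?nsq_ge0.
Qed.

Lemma rdotC x y : rdot x y = rdot y x.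
Proof. by rewrite /rdot hdotC conjCc; case: (hdot H y x). Qed.

Lemma rdotDl x y z : rdot (x + y) z = rdot x z + rdot y z.
Proof. by rewrite /rdot linearDl raddfD. Qed.

Lemma rdotZl (a : R) x z : rdot (a%:C%C *: x) z = a * rdot x z.
Proof.
rewrite /rdot linearZl_LR/=.
by case: (hdot H x z) => b c /=; rewrite mul0r subr0.
Qed.

Lemma nsqD x y : nsq (x + y) = nsq x + nsq y + 2 * rdot x y.
Proof.
by rewrite /nsq rdotDl !(rdotC _ (x + y)) !rdotDl (rdotC y x); ring.
Qed.

Lemma nsqZ (a : C) x : nsq (a *: x) = normsq a * nsq x.
Proof.
apply: complexI; rewrite rmorphM /= normsqE -!hdotE linearZl_LR linearZr_LR/=.
by rewrite mulrA.
Qed.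

Lemma normsqR (a : R) : normsq (a%:C%C) = a ^+ 2.
Proof. by rewrite /normsq /= expr0n addr0. Qed.

Lemma nsqN x : nsq (- x) = nsq x.
Proof.
rewrite -scaleN1r nsqZ -(rmorphN1 (real_complex R)) normsqR.
by rewrite sqrrN expr1n mul1r.
Qed.

Lemma rdotNr x y : rdot x (- y) = - rdot x y.
Proof. by rewrite /rdot linearNr raddfN. Qed.

Lemma nsqB x y : nsq (x - y) = nsq x + nsq y - 2 * rdot x y.
Proof. by rewrite nsqD nsqN rdotNr mulrN. Qed.

Lemma nsqBC x y : nsq (x - y) = nsq (y - x).
Proof. by rewrite -nsqN opprB. Qed.

Lemma nsqD_le x y : nsq (x + y) <= 2 * nsq x + 2 * nsq y.
Proof. by have := nsq_ge0 (x - y); rewrite nsqB nsqD => ?; lra. Qed.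

Lemma unitary_nsq u x : nsq (u x) = nsq x.
Proof. by rewrite /nsq /rdot unitary_dot. Qed.

Lemma unitaryB u x y : u (x - y) = u x - u y.
Proof.
by have := unitary_linear u (-1) y x; rewrite !scaleN1r ![- _ + _]addrC.
Qed.

Lemma unitaryZ u a x : u (a *: x) = a *: u x.
Proof.
have u0 : u 0 = 0 by rewrite -(subrr 0) unitaryB !subrr.
by have := unitary_linear u a x 0; rewrite !addr0 u0 addr0.
Qed.

Lemma normsqC (a : C) : normsq a^* = normsq a.
Proof. by rewrite conjCc; case: a => a b; rewrite /normsq /= sqrrN. Qed.

Lemma normsqM (a b : C) : normsq (a * b) = normsq a * normsq b.
Proof. by case: a b => a b [c d]; rewrite /normsq /=; ring. Qed.

Lemma hdot_sumr x (c : nat -> C) (f : nat -> H) n :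
  hdot H x (\sum_(0 <= i < n) c i *: f i) =
  \sum_(0 <= i < n) (c i)^* * hdot H x (f i).
Proof. by rewrite linear_sumr; apply: eq_bigr => i _; rewrite linearZr_LR. Qed.

Lemma hdot_sum_orthonormal (f : nat -> H) (c : nat -> C) n k :
  orthonormal_seq f ->
  hdot H (\sum_(0 <= i < n) c i *: f i) (f k) = if (k < n)%N then c k else 0.
Proof.
move=> fo; rewrite linear_sumlz.
under eq_bigr => i _ do rewrite linearZl_LR/= fo.
case: ifPn => kn; last first.
  rewrite big_nat big1// => i /andP[_ iN].
  by rewrite (_ : (i == k) = false) ?mulr0//; apply: contraNF kn => /eqP <-.
rewrite (bigD1_seq k) ?iota_uniq//=; last by rewrite mem_index_iota.
by rewrite eqxx mulr1 big1 ?addr0// => i /negPf ->; rewrite mulr0.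
Qed.

(** Pythagoras: the cross terms of the squared norm vanish. *)
Lemma nsq_sum_orthonormal (f : nat -> H) (c : nat -> C) n :
  orthonormal_seq f ->
  nsq (\sum_(0 <= i < n) c i *: f i) = \sum_(0 <= i < n) normsq (c i).
Proof.
move=> fo; apply: complexI; rewrite -hdotE hdot_sumr rmorph_sum/= big_nat.
rewrite [RHS]big_nat; apply: eq_bigr => i /andP[_ iN].
by rewrite hdot_sum_orthonormal// iN normsqE mulrC.
Qed.

(** The partial sum [s] is the orthogonal projection of [x], so
[nsq (x - s) = nsq x - nsq s]. *)
Lemma bessel (f : nat -> H) x n : orthonormal_seq f ->
  \sum_(0 <= i < n) normsq (hdot H x (f i)) <= nsq x.
Proof.
move=> fo; set s := \sum_(0 <= i < n) hdot H x (f i) *: f i.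
have := nsq_ge0 (x - s); rewrite nsqB.
have -> : rdot x s = nsq s.
  congr complex.Re; rewrite hdot_sumr /s hdot_sumr big_nat [RHS]big_nat.
  by apply: eq_bigr => i /andP[_ iN]; rewrite hdot_sum_orthonormal// iN.
by rewrite /s nsq_sum_orthonormal// => ?; lra.
Qed.

Lemma sqrt_nsqD x y :
  Num.sqrt (nsq (x + y)) <= Num.sqrt (nsq x) + Num.sqrt (nsq y).
Proof. by rewrite -lecR rmorphD/= -!hilbert_normE ler_normD. Qed.

Lemma dist_sqrt_nsq x y :
  `|Num.sqrt (nsq x) - Num.sqrt (nsq y)| <= Num.sqrt (nsq (x - y)).
Proof.
have half (a b : H) : Num.sqrt (nsq a) - Num.sqrt (nsq b) <= Num.sqrt (nsq (a - b)).
  by rewrite lerBlDr -lecR rmorphD/= -!hilbert_normE -lerBlDr lerB_dist.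
by rewrite ler_norml half lerNl opprB nsqBC half.
Qed.

Lemma cvg_nsqB (T : Type) (F : set_system T) (h : T -> H) x :
  Filter F -> h @ F --> x -> forall e : R, 0 < e ->
  \forall t \near F, nsq (x - h t) < e.
Proof.
move=> FF hx e e0.
have se0 : (0 : C) < (Num.sqrt e)%:C%C by rewrite ltcR sqrtr_gt0.
have /cvgr_dist_lt/(_ _ se0) := hx; apply: filterS => t.
by rewrite hilbert_normE ltcR ltr_sqrt.
Qed.

(** Square roots are used because only [Num.sqrt \o nsq] is Lipschitz. *)
Lemma cvg_nsq (T : Type) (F : set_system T) (h : T -> H) x :
  Filter F -> h @ F --> x -> nsq (h t) @[t --> F] --> nsq x.
Proof.
move=> FF hx.
have -> : (fun t => nsq (h t)) = fun t => Num.sqrt (nsq (h t)) * Num.sqrt (nsq (h t)).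
  by apply/funext => t; rewrite -expr2 sqr_sqrtr ?nsq_ge0.
rewrite -[nsq x]sqr_sqrtr ?nsq_ge0// expr2.
suff : Num.sqrt (nsq (h t)) @[t --> F] --> Num.sqrt (nsq x) by move=> s; exact: cvgM.
apply/cvgrPdist_lt => e e0; have e20 : 0 < e ^+ 2 by rewrite exprn_gt0.
apply: filterS (cvg_nsqB FF hx e20) => t xt.
apply: le_lt_trans (dist_sqrt_nsq _ _) _.
by rewrite -[e]gtr0_norm// -sqrtr_sqr ltr_sqrt.
Qed.
End HilbertGeometry.

(** * Estimates from a Schmidt decomposition *)

Section SchmidtEstimates.
Context {R : realType} {H : complex_hilbert R}.
Implicit Types (T : H -> H).

(** Dividing the singular values by [r] makes every later estimate a comparison
with 1; finite partial sums suffice for all of them. *)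
Lemma schatten_normP (p r : R) T : 0 < p -> 0 < r ->
  (schatten_norm p T < r%:E)%E ->
  exists2 s, singular_values T s &
    forall n, \sum_(0 <= i < n) (s i / r) `^ p <= 1.
Proof.
move=> p0 r0 /ereal_inf_lt[_ [s sT <-] sr]; exists s => // n.
have s0 i : 0 <= s i by case: sT.
have ip0 : 0 < p^-1 by rewrite invr_gt0.
have : (\sum_(0 <= i < n) (s i `^ p)%:E <= (r `^ p)%:E)%E.
  apply: (@le_trans _ _ (\sum_(0 <= i <oo) (s i `^ p)%:E)%E).
    by apply: nneseries_lim_ge => i _ _; rewrite lee_fin powR_ge0.
  rewrite -[leLHS]poweRe1 ?nneseries_ge0//; last first.
    by move=> i _ _; rewrite lee_fin powR_ge0.
  rewrite -(mulVf (lt0r_neq0 p0)) poweRrM -poweR_EFin.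
  by apply: gt0_ler_poweR; rewrite ?(ltW p0) ?(ltW sr)// in_itv/=
    ?leey ?poweR_ge0 ?lee_fin ?(ltW r0).
rewrite sumEFin lee_fin => h.
under eq_bigr do rewrite powRM ?invr_ge0 ?(ltW r0)//.
rewrite -mulr_suml -powR_inv1 ?(ltW r0)// -powRrM mulN1r powRN.
by rewrite ler_pdivrMr ?powR_gt0// mul1r.
Qed.

(** A Schmidt decomposition [T x = \sum_i s_i <x, e_i> f_i], kept in the form in
which it is used: by Pythagoras the [f_i] disappear from
[nsq (T x) = \sum_i s_i^2 |<x, e_i>|^2], and [z i = s_i / r]. *)
Lemma schatten_schmidt (p r : R) T : 0 < p -> 0 < r ->
  (schatten_norm p T < r%:E)%E ->
  exists z e, [/\ forall i, 0 <= z i <= 1, z i @[i --> \oo] --> (0 : R),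
    forall n, \sum_(0 <= i < n) z i `^ p <= 1, orthonormal_seq e
    & forall x, \sum_(0 <= i < n) z i ^+ 2 * normsq (hdot H x (e i))
                  @[n --> \oo] --> nsq (T x) / r ^+ 2].
Proof.
move=> p0 r0 /(schatten_normP p0 r0)[s [s0 _ scvg [e [f [eo fo sT]]]] s1].
have z0 i : 0 <= s i / r by rewrite divr_ge0 // ltW.
exists (fun i => s i / r), e; split => //.
- move=> i; rewrite z0/=.
  have : (s i / r) `^ p <= 1.
    apply: le_trans (s1 i.+1); rewrite big_nat_recr//= lerDr.
    by apply: sumr_ge0 => *; rewrite powR_ge0.
  have [//|z1] := leP (s i / r) 1.
  have := gt0_ltr_powR p0 _ _ z1.
  by rewrite !nnegrE powR1 ler01 z0 ltNge => /(_ isT isT)/negPf ->.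
- by have := cvgMr_tmp (b := r^-1) scvg; rewrite mul0r; apply.
- move=> x; rewrite (_ : (fun _ => _) = fun n =>
    nsq (\sum_(0 <= i < n) ((s i)%:C%C * hdot H x (e i)) *: f i) / r ^+ 2).
    by apply: cvgMr_tmp; apply: cvg_nsq; exact: sT.
  apply/funext => n; rewrite nsq_sum_orthonormal// mulr_suml.
  by apply: eq_bigr => i _; rewrite normsqM normsqR exprMn exprVn mulrAC.
Qed.

(** The Schatten norm dominates the operator norm: all the [z i] are at most 1,
and Bessel's inequality bounds the rest. *)
Lemma schatten_norm_opnorm (p r : R) T x : 0 < p -> 0 < r ->
  (schatten_norm p T < r%:E)%E -> nsq (T x) <= r ^+ 2 * nsq x.
Proof.
move=> p0 r0 /(schatten_schmidt p0 r0)[z [e [z01 _ _ eo /(_ x) Tx]]].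
rewrite mulrC -ler_pdivrMr ?exprn_gt0//.
apply: (@cvgr_to_le _ \oo _ _ _ _ _ Tx); apply: nearW => n.
apply: le_trans (bessel x n eo); apply: ler_sum => i _.
by rewrite ler_piMl ?normsq_ge0// exprn_ile1//; case/andP: (z01 i).
Qed.

(** Hoelder's inequality [|| T A ||_2 <= C || T ||_p] for the diagonal operator [A]
with squared eigenvalues [w j ^+ k]. With [a j i = |<b j, e i>|^2], the left-hand
side is [r^2] times the double sum of [w_j^k z_i^2 a_ji]. The elementary Young
inequality [w^k z^2 <= (z^2)^(k+1) + w^(k+1)] separates the two indices, and the
matrix [a] is doubly substochastic by Bessel, for [b] and for [e]. *)
Lemma schatten_norm_weighted (p r : R) (k : nat) (w : nat -> R) (c : R) T
    (b : nat -> H) N :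
  0 < p -> p <= 2 * k.+1%:R -> 0 < r -> orthonormal_seq b ->
  (forall i, 0 < w i) -> (forall n, \sum_(0 <= i < n) w i ^+ k.+1 <= c) ->
  (schatten_norm p T < r%:E)%E ->
  \sum_(0 <= j < N) w j ^+ k * nsq (T (b j)) <= (1 + c) * r ^+ 2.
Proof.
move=> p0 pk r0 bo w0 wc /(schatten_schmidt p0 r0)[z [e [z01 _ z1 eo Tx]]].
rewrite -ler_pdivrMr ?exprn_gt0// mulr_suml.
under eq_bigr => j _ do rewrite -mulrA.
have cv : \sum_(0 <= j < N) w j ^+ k *
    \sum_(0 <= i < n) z i ^+ 2 * normsq (hdot H (b j) (e i)) @[n --> \oo] -->
    \sum_(0 <= j < N) w j ^+ k * (nsq (T (b j)) / r ^+ 2).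
  by apply: cvg_big => [|j _]; [exact: add_continuous|apply: cvgMl_tmp; exact: Tx].
apply: (@cvgr_to_le _ \oo _ _ _ _ _ cv); apply: nearW => n.
pose a j i := normsq (hdot H (b j) (e i)).
apply: (@le_trans _ _ (\sum_(0 <= j < N) \sum_(0 <= i < n)
    ((z i ^+ 2) ^+ k.+1 * a j i + w j ^+ k.+1 * a j i))).
  apply: ler_sum => j _; rewrite mulr_sumr; apply: ler_sum => i _.
  rewrite mulrA -mulrDl ler_wpM2r ?normsq_ge0//.
  (* The larger of [w j] and [z i ^+ 2] tells which power to keep. *)
  have wj := w0 j; have zi := sqr_ge0 (z i).
  have [zw|/ltW wz] := leP (z i ^+ 2) (w j).
    apply: ler_wpDl; first by rewrite exprn_ge0.
    by rewrite [leRHS]exprSr ler_wpM2l// exprn_ge0 ?ltW.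
  apply: ler_wpDr; first by rewrite exprn_ge0 ?ltW.
  by rewrite [leRHS]exprSr ler_wpM2r// lerXn2r ?nnegrE// ltW.
under eq_bigr do rewrite big_split/=.
rewrite big_split/= lerD//.
  rewrite exchange_big_nat/=; apply: le_trans (z1 n); apply: ler_sum => i _.
  have /andP[zi0 zi1] := z01 i.
  rewrite -mulr_sumr -[leRHS]mulr1; apply: ler_pM.
  - by rewrite exprn_ge0 ?sqr_ge0.
  - by apply: sumr_ge0 => *; exact: normsq_ge0.
  - rewrite -exprM -powR_mulrn//; have [zi|zi] := eqVneq (z i) 0.
      by rewrite zi !powR0 ?gt_eqF.
    by apply: ger_powR; rewrite ?lt0r ?zi ?zi0 ?natrM.
  - apply: le_trans (_ : nsq (e i) <= 1); last by rewrite /nsq /rdot eo eqxx.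
    apply: le_trans (bessel (e i) N bo); apply: ler_sum => j _.
    by rewrite /a hdotC normsqC.
apply: le_trans (wc N); apply: ler_sum => j _.
rewrite -mulr_sumr ler_piMr ?exprn_ge0 ?(ltW (w0 j))//.
apply: le_trans (bessel (b j) n eo) _.
by rewrite /nsq /rdot bo eqxx.
Qed.

(** Orthonormal sequences converge weakly to 0. *)
Lemma hdot_orthonormal_cvg0 (b : nat -> H) x : orthonormal_seq b ->
  normsq (hdot H x (b j)) @[j --> \oo] --> (0 : R).
Proof.
move=> bo; apply: cvg_series_cvg_0; apply: nondecreasing_is_cvgn.
  by apply: nondecreasing_series => i _ _; exact: normsq_ge0.
by exists (nsq x) => _ [n _ <-]; exact: bessel.
Qed.

(** Compact operators turn the weak convergence of [b] to 0 into norm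
convergence. Up to [eps], the squared norm [nsq (T (b j))] is a sum over finitely
many [i], uniformly in [j], since the singular values tend to 0; each of these
finitely many terms tends to 0. *)
Lemma schatten_norm_orthonormal_cvg0 (p r : R) T (b : nat -> H) : 0 < p -> 0 < r ->
  orthonormal_seq b -> (schatten_norm p T < r%:E)%E ->
  nsq (T (b j)) @[j --> \oo] --> (0 : R).
Proof.
move=> p0 r0 bo /(schatten_schmidt p0 r0)[z [e [z01 zcvg _ eo Tx]]].
pose a j i := normsq (hdot H (b j) (e i)).
suff h : nsq (T (b j)) / r ^+ 2 @[j --> \oo] --> (0 : R).
  have := cvgMr_tmp (b := r ^+ 2) h; rewrite mul0r.
  under eq_fun do rewrite divfK ?gt_eqF ?exprn_gt0//.
  exact.
have tail eps : 0 < eps -> exists M, forall j,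
    nsq (T (b j)) / r ^+ 2 <= \sum_(0 <= i < M) a j i + eps.
  move=> e0; have [M _ zM] : \forall i \near \oo, z i < eps.
    by move/cvgr_lt : zcvg; apply.
  exists M => j; apply: (@cvgr_to_le _ \oo _ _ _ _ _ (Tx (b j))); apply: nearW => n.
  (* Below [M] use [z i <= 1]; from [M] on use [z i ^+ 2 <= z i < eps]. *)
  apply: (@le_trans _ _ (\sum_(0 <= i < n) (a j i * (i < M)%:R + eps * a j i))).
    apply: ler_sum => i _; rewrite -/(a j i).
    have /andP[zi0 zi1] := z01 i.
    have [iM|Mi] := ltnP i M.
      apply: ler_wpDr; first by rewrite mulr_ge0 ?normsq_ge0 // ltW.
      by rewrite mulr1 ler_piMl ?normsq_ge0 ?exprn_ile1.
    rewrite mulr0 add0r ler_wpM2r ?normsq_ge0//.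
    apply: le_trans (ltW (zM i Mi)); by rewrite expr2 ler_piMl.
  rewrite big_split/= lerD//.
    have [nM|/ltnW Mn] := leqP n M.
      rewrite (big_cat_nat (n := n) (p := M))//=.
      apply: ler_wpDr; first by apply: sumr_ge0 => *; exact: normsq_ge0.
      by apply: ler_sum => i _; rewrite ler_piMr ?normsq_ge0//; case: (_ < _)%N.
    rewrite (big_cat_nat (n := M) (p := n))//= [X in _ + X]big_nat [X in _ + X]big1 ?addr0.
      by apply: ler_sum => i _; rewrite ler_piMr ?normsq_ge0//; case: (_ < _)%N.
    by move=> i /andP[Mi _]; rewrite ltnNge Mi mulr0.
  rewrite -mulr_sumr ler_piMr ?(ltW e0)//; apply: le_trans (bessel (b j) n eo) _.
  by rewrite /nsq /rdot bo eqxx.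
apply/cvgrPdist_le => eps e0; have e20 : 0 < eps / 2 by rewrite divr_gt0.
have [M hM] := tail _ e20.
have cM : \sum_(0 <= i < M) a j i @[j --> \oo] --> \sum_(0 <= i < M) (0 : R).
  apply: cvg_big => [|i _]; first exact: add_continuous.
  under eq_fun do rewrite /a hdotC normsqC.
  exact: hdot_orthonormal_cvg0.
rewrite big1// in cM.
move/cvgr_le : cM => /(_ _ e20); apply: filterS => j aj.
rewrite sub0r normrN ger0_norm; last by rewrite divr_ge0 ?nsq_ge0 ?exprn_ge0 ?ltW.
by apply: le_trans (hM j) _; lra.
Qed.

End SchmidtEstimates.

(** * Square-summable sequences of vectors as a real Hilbert space *)

Section HilbertSum.
Context {R : realType} (H : complex_hilbert R).
Local Notation C := R[i].
Implicit Types (x y z : nat -> H).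

Definition hsummable : {pred nat -> H} :=
  [pred x : nat -> H | `[< cvgn (series (fun n => nsq (x n))) >]].

Lemma hsummableP x : reflect (cvgn (series (fun n => nsq (x n)))) (x \in hsummable).
Proof. exact: asboolP. Qed.

Lemma hsummable_bound x (M : R) :
  (forall n, \sum_(0 <= i < n) nsq (x i) <= M) -> x \in hsummable.
Proof.
move=> xM; apply/hsummableP; apply: nondecreasing_is_cvgn.
  by apply: nondecreasing_series => i _ _; exact: nsq_ge0.
by exists M => _ [n _ <-]; exact: xM.
Qed.

Lemma hsummable_sum_le x n : x \in hsummable ->
  \sum_(0 <= i < n) nsq (x i) <= limn (series (fun n => nsq (x n))).
Proof.
move/hsummableP => sx; apply: nondecreasing_cvgn_le; last exact: sx.
by apply: nondecreasing_series => i _ _; exact: nsq_ge0.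
Qed.

Lemma hsummable_zmod : zmod_closed hsummable.
Proof.
split.
  apply: (@hsummable_bound _ 0) => n; rewrite big1// => i _.
  by rewrite /nsq/rdot linear0l.
move=> x y sx sy.
apply: (@hsummable_bound _ (2 * limn (series (fun n => nsq (x n)))
  + 2 * limn (series (fun n => nsq (y n))))) => n.
apply: (@le_trans _ _ (\sum_(0 <= i < n) (2 * nsq (x i) + 2 * nsq (y i)))).
  apply: ler_sum => i _; rewrite -(nsqN (y i)).
  exact: nsqD_le (x i) (- y i).
by rewrite big_split/= -!mulr_sumr lerD// ler_wpM2l// hsummable_sum_le.
Qed.

HB.instance Definition _ :=
  GRing.isZmodClosed.Build (nat -> H) hsummable hsummable_zmod.

(** Although [H] is complex, only real scalars act on [hsum]: property (FH) is
about real Hilbert spaces. *)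
Record hsum := Hsum { hsum_seq :> nat -> H ; _ : hsum_seq \in hsummable }.

HB.instance Definition _ := [isSub for hsum_seq].
HB.instance Definition _ := [Choice of hsum by <:].
HB.instance Definition _ := [SubChoice_isSubZmodule of hsum by <:].

Implicit Types f g : hsum.

Lemma hsumP f : (f : nat -> H) \in hsummable.
Proof. by case: f. Qed.

Lemma hsum_ext f g : (forall n, f n = g n) -> f = g.
Proof. by move=> fg; apply/val_inj/funext. Qed.

Lemma hsumDE f g n : (f + g) n = f n + g n. Proof. by []. Qed.
Lemma hsumNE f n : (- f) n = - f n. Proof. by []. Qed.

Lemma hscale_subproof (a : R) f : (fun n => a%:C%C *: f n) \in hsummable.
Proof.
apply: (@hsummable_bound _ (a ^+ 2 * limn (series (fun n => nsq (f n))))) => n.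
under eq_bigr do rewrite nsqZ normsqR.
by rewrite -mulr_sumr ler_wpM2l ?sqr_ge0// hsummable_sum_le// hsumP.
Qed.
Definition hscale (a : R) f : hsum := Hsum (hscale_subproof a f).

Lemma hscaleA a b f : hscale a (hscale b f) = hscale (a * b) f.
Proof. by apply: hsum_ext => n /=; rewrite scalerA rmorphM. Qed.
Lemma hscale1 : left_id 1 hscale.
Proof. by move=> f; apply: hsum_ext => n /=; rewrite scale1r. Qed.
Lemma hscaleDr : right_distributive hscale +%R.
Proof. by move=> a f g; apply: hsum_ext => n; rewrite hsumDE; exact: scalerDr. Qed.
Lemma hscaleDl f : {morph hscale^~ f : a b / a + b}.
Proof. by move=> a b; apply: hsum_ext => n; rewrite hsumDE /= rmorphD scalerDl. Qed.

HB.instance Definition _ :=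
  GRing.Zmodule_isLmodule.Build R hsum hscaleA hscale1 hscaleDr hscaleDl.

Lemma hsumZE (a : R) f n : (a *: f) n = a%:C%C *: f n. Proof. by []. Qed.

Definition hsum_dot f g : R := limn (series (fun n => rdot (f n) (g n))).

Lemma hsum_nsq_cvg f : cvgn (series (fun n => nsq (f n))).
Proof. exact/hsummableP/hsumP. Qed.

(** Polarization: it reduces the summability of the inner products to that of the
squared norms of a sum and a difference. *)
Lemma rdot_polar (a b : H) : rdot a b = 4^-1 * (nsq (a + b) - nsq (a - b)).
Proof. by rewrite nsqD nsqB; field. Qed.

Lemma hsum_dot_cvg f g : cvgn (series (fun n => rdot (f n) (g n))).
Proof.
under eq_fun do rewrite rdot_polar.
apply: is_cvg_seriesZ.
exact: is_cvg_seriesB (@hsum_nsq_cvg (f + g)) (@hsum_nsq_cvg (f - g)).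
Qed.

Lemma hsum_dotC f g : hsum_dot f g = hsum_dot g f.
Proof.
by rewrite /hsum_dot; under eq_fun do rewrite rdotC.
Qed.

Lemma hsum_dotD f f' g : hsum_dot (f + f') g = hsum_dot f g + hsum_dot f' g.
Proof.
rewrite /hsum_dot -lim_seriesD; [|exact: hsum_dot_cvg..].
by congr (limn (series _)); apply/funext => n; rewrite hsumDE rdotDl.
Qed.

Lemma hsum_dotZ (a : R) f g : hsum_dot (a *: f) g = a * hsum_dot f g.
Proof.
rewrite /hsum_dot -[RHS]/(a *: _) -lim_seriesZ; last exact: hsum_dot_cvg.
by congr (limn (series _)); apply/funext => n; rewrite hsumZE rdotZl.
Qed.

Lemma hsum_dot_ge f n : \sum_(0 <= i < n) nsq (f i) <= hsum_dot f f.
Proof. exact: hsummable_sum_le (hsumP f). Qed.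

Lemma hsum_dot_le f (M : R) :
  (forall n, \sum_(0 <= i < n) nsq (f i) <= M) -> hsum_dot f f <= M.
Proof.
by move=> fM; apply: limr_le; [exact: hsum_nsq_cvg|apply: nearW => n; exact: fM].
Qed.

Lemma hsum_dot_ge1 f n : nsq (f n) <= hsum_dot f f.
Proof.
apply: le_trans (hsum_dot_ge f n.+1); rewrite big_nat_recr//= lerDr sumr_ge0//.
by move=> i _; exact: nsq_ge0.
Qed.

Lemma hsum_dot_ge0 f : 0 <= hsum_dot f f.
Proof. exact: le_trans (nsq_ge0 _) (hsum_dot_ge1 f 0). Qed.

Lemma hsum_dot0 f : hsum_dot f f = 0 -> f = 0.
Proof.
move=> f0; apply: hsum_ext => n; apply: nsq0_eq0; apply/eqP.
by rewrite eq_le nsq_ge0 -f0 hsum_dot_ge1.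
Qed.

Lemma hsum_dotNl f g : hsum_dot (- f) g = - hsum_dot f g.
Proof. by rewrite -scaleN1r hsum_dotZ mulN1r. Qed.

Let dot_addl g : zmod_morphism (hsum_dot^~ g).
Proof. by move=> f f'; rewrite hsum_dotD hsum_dotNl. Qed.
Let dot_addr f : zmod_morphism (hsum_dot f).
Proof. by move=> g g'; rewrite !(hsum_dotC f) dot_addl. Qed.
Let dot_scalel g : scalable_for *%R (hsum_dot^~ g).
Proof. by move=> a f; rewrite hsum_dotZ. Qed.
Let dot_scaler f : scalable_for (idfun \; *%R) (hsum_dot f).
Proof. by move=> a g; rewrite hsum_dotC hsum_dotZ hsum_dotC. Qed.
Let dot_sym f g : hsum_dot f g = (-1) ^+ false * idfun (hsum_dot g f).
Proof. by rewrite expr0 mul1r hsum_dotC. Qed.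
Let dot_gt0 f : f != 0 -> 0 < hsum_dot f f.
Proof.
move=> f0; rewrite lt_neqAle hsum_dot_ge0 andbT.
by apply: contra f0 => /eqP/esym/hsum_dot0 ->.
Qed.

HB.instance Definition _ := @isBilinear.Build R hsum hsum R *%R (idfun \; *%R)
  hsum_dot dot_addl dot_addr dot_scalel dot_scaler.
HB.instance Definition _ := @isHermitianSesquilinear.Build R hsum false idfun
  hsum_dot dot_sym.
HB.instance Definition _ := @isDotProduct.Build R hsum hsum_dot dot_gt0.

Definition hsum_norm f : R := Num.sqrt (hsum_dot f f).

Lemma hsum_norm_ge0 f : 0 <= hsum_norm f. Proof. exact: sqrtr_ge0. Qed.

Lemma hsum_norm_sqr f : hsum_norm f ^+ 2 = hsum_dot f f.
Proof. by rewrite sqr_sqrtr ?hsum_dot_ge0. Qed.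

Lemma hsum_norm0 f : hsum_norm f = 0 -> f = 0.
Proof. by move=> f0; apply: hsum_dot0; rewrite -hsum_norm_sqr f0 expr0n. Qed.

Lemma hsum_normZ (a : R) f : hsum_norm (a *: f) = `|a| * hsum_norm f.
Proof.
rewrite /hsum_norm hsum_dotZ hsum_dotC hsum_dotZ mulrA -expr2 sqrtrM ?sqr_ge0//.
by rewrite sqrtr_sqr.
Qed.

Lemma hsum_cauchy_schwarz f g : hsum_dot f g <= hsum_norm f * hsum_norm g.
Proof.
have [/hsum_norm0->|f0] := eqVneq (hsum_norm f) 0.
  by rewrite -(scale0r 0) hsum_dotZ hsum_normZ normr0 !mul0r.
have [/hsum_norm0->|g0] := eqVneq (hsum_norm g) 0.
  by rewrite -(scale0r 0) hsum_dotC hsum_dotZ hsum_normZ normr0 !mul0r mulr0.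
set a := hsum_norm f; set b := hsum_norm g.
have a0 : 0 < a by rewrite lt_neqAle eq_sym f0 hsum_norm_ge0.
have b0 : 0 < b by rewrite lt_neqAle eq_sym g0 hsum_norm_ge0.
(* For vectors scaled to the same norm, the squared norm of the difference is
   a positive multiple of the gap in the inequality. *)
have := hsum_dot_ge0 (b *: f - a *: g).
rewrite dot_addl !dot_addr !hsum_dotZ !(hsum_dotC _ (_ *: _)) !hsum_dotZ.
rewrite -!hsum_norm_sqr -/a -/b (hsum_dotC g f) => h.
have : 0 <= 2 * (a * b) * (a * b - hsum_dot f g).
  by apply: le_trans h _; rewrite le_eqVlt; apply/orP; left; apply/eqP; ring.
by rewrite pmulr_rge0 ?subr_ge0// !mulr_gt0.
Qed.

Lemma hsum_normD f g : hsum_norm (f + g) <= hsum_norm f + hsum_norm g.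
Proof.
rewrite -(@ler_pXn2r _ 2)// ?nnegrE ?addr_ge0 ?hsum_norm_ge0//.
rewrite hsum_norm_sqr hsum_dotD !(hsum_dotC _ (f + g)) !hsum_dotD.
rewrite (hsum_dotC g f) -!hsum_norm_sqr sqrrD.
by have := hsum_cauchy_schwarz f g => ?; lra.
Qed.

HB.instance Definition _ :=
  Lmodule_isNormed.Build R hsum hsum_normD hsum_normZ hsum_norm0.

Lemma hsum_ballE f (e : R) g : ball f e g = (hsum_norm (f - g) < e) :> Prop.
Proof. by rewrite -ball_normE. Qed.

(** A Cauchy filter converges coordinatewise, to [y]. The bound on the finite
partial sums of [nsq (f i - g i)] survives the limit in [g] coordinate by
coordinate, which gives both the summability of [y] and norm convergence. *)
Lemma hsum_complete (F : set_system hsum) : ProperFilter F -> cauchy F -> cvg F.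
Proof.
move=> FF /cauchy_ballP F_cauchy.
have F_pair (e : R) : 0 < e -> F [set f | F [set g | hsum_norm (f - g) < e]].
  move=> e0; have [[A B] /= [FA FB] AB] := F_cauchy _ e0.
  apply: filterS FA => f Af; apply: filterS FB => g Bg.
  by have := AB (f, g) (conj Af Bg); rewrite /= hsum_ballE.
have coord n : cvg (f n @[f --> F]).
  apply: cauchy_cvg; apply/cauchy_ballP => e e0.
  have [r er] : exists r : R, e = r%:C%C.
    by exists (complex.Re e); rewrite RRe_real ?gtr0_real.
  subst e; rewrite ltcR in e0.
  have [[A B] /= [FA FB] AB] := F_cauchy _ e0.
  exists ([set f n | f in A], [set f n | f in B]) => /=.
    by split; [apply: filterS FA | apply: filterS FB] => f; exists f.
  move=> [_ _] [/= [f Af <-] [g Bg <-]].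
  have := AB (f, g) (conj Af Bg); rewrite /= hsum_ballE -ball_normE /ball_/= => fg.
  rewrite hilbert_normE ltcR; apply: le_lt_trans fg.
  by rewrite /hsum_norm ler_wsqrtr// (hsum_dot_ge1 (f - g) n).
pose y n : H := lim (f n @[f --> F]).
have Fy (e : R) : 0 < e ->
    F [set f | forall n, \sum_(0 <= i < n) nsq (f i - y i) <= e ^+ 2].
  move=> e0; apply: filterS (F_pair _ e0) => f fe n.
  apply: (@cvgr_to_le _ F _ _ (fun g : hsum => \sum_(0 <= i < n) nsq (f i - g i))).
    apply: cvg_big => [|i _]; first exact: add_continuous.
    by apply: cvg_nsq; apply: cvgB; [exact: cvg_cst|exact: coord].
  apply: filterS fe => g fg; apply: le_trans (hsum_dot_ge (f - g) n) _.
  by rewrite -hsum_norm_sqr ler_pXn2r ?nnegrE ?hsum_norm_ge0 ?ltW.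
have [f0 f0y] := filter_ex (Fy 1 ltr01).
have sd : (f0 : nat -> H) - y \in hsummable.
  by apply: (@hsummable_bound _ (1 ^+ 2)) => n; exact: f0y.
have sy : y \in hsummable.
  have -> : y = (f0 : nat -> H) - ((f0 : nat -> H) - y) by rewrite subKr.
  by rewrite rpredB// hsumP.
apply/cvg_ex; exists (Hsum sy); apply/fcvg_ballP => e e0.
have e2 : 0 < e / 2 by rewrite divr_gt0.
apply: filterS (Fy _ e2) => f fy; rewrite hsum_ballE.
apply: (@le_lt_trans _ _ (e / 2)); last by lra.
rewrite -(@ler_pXn2r _ 2)// ?nnegrE ?hsum_norm_ge0 ?(ltW e2)// hsum_norm_sqr.
apply: hsum_dot_le => n; apply: le_trans (fy n); apply: ler_sum => i _.
by rewrite -nsqN opprB.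
Qed.

HB.instance Definition _ := Uniform_isComplete.Build hsum hsum_complete.

Lemma hsum_hnormE f : `|f| ^+ 2 = hsum_dot f f.
Proof. exact: hsum_norm_sqr. Qed.

Definition hsum_hilbert : real_hilbert R := @Hilbert R idfun hsum hsum_dot hsum_hnormE.

Section Amplification.
Variable u : unitary H.

Lemma amplify_subproof f : (fun n => u (f n)) \in hsummable.
Proof.
apply: (@hsummable_bound _ (hsum_dot f f)) => n.
by under eq_bigr do rewrite unitary_nsq; exact: hsum_dot_ge.
Qed.
Definition amplify_fun f : hsum := Hsum (amplify_subproof f).

Lemma amplify_linear : linear (amplify_fun : hsum_hilbert -> hsum_hilbert).
Proof. by move=> a f g; apply: hsum_ext => n; exact: unitary_linear. Qed.

Lemma amplify_dot f g : hsum_dot (amplify_fun f) (amplify_fun g) = hsum_dot f g.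
Proof.
by rewrite /hsum_dot/=; under eq_fun do rewrite /rdot unitary_dot.
Qed.

End Amplification.

Lemma amplify_surj (u : unitary H) g : exists f, amplify_fun u f = g.
Proof.
exists (amplify_fun (unitary_inv u) g); apply: hsum_ext => n.
exact: unitary_invfK.
Qed.

(** Left multiplication by [u], when the elements of [hsum] are read as
Hilbert-Schmidt operators. *)
Definition amplify (u : unitary H) : unitary hsum_hilbert :=
  @Unitary R idfun hsum_hilbert (amplify_fun u) (amplify_linear u) (amplify_dot u)
    (amplify_surj u).

Lemma amplifyM (u v : unitary H) : amplify (u * v)%g = (amplify u * amplify v)%g.
Proof. by apply: unitary_ext => f; apply: hsum_ext. Qed.

End HilbertSum.

(** * A convergent p-series *)

Section Weights.
Context {R : realType}.

(** The mean value inequality for the power function. *)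
Lemma subrX_le (u v : R) k : 0 <= u <= v ->
  v ^+ k.+1 - u ^+ k.+1 <= k.+1%:R * (v - u) * v ^+ k.
Proof.
move=> /andP[u0 uv]; have v0 := le_trans u0 uv; elim: k => [|k IHk].
  by rewrite !expr1 expr0 mul1r mulr1.
have -> : v ^+ k.+2 - u ^+ k.+2 =
    v * (v ^+ k.+1 - u ^+ k.+1) + (v - u) * u ^+ k.+1 by rewrite !exprS; ring.
have -> : k.+2%:R * (v - u) * v ^+ k.+1 =
    v * (k.+1%:R * (v - u) * v ^+ k) + (v - u) * v ^+ k.+1.
  by rewrite -[k.+2%:R]natr1 exprS; ring.
by rewrite lerD ?ler_wpM2l ?subr_ge0// lerXn2r.
Qed.

(** The series [\sum_i (i+1)^(-1-1/k)] converges, with [y i] the [k]-th root of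
[i+1]. Its terms are dominated by a telescoping sum: the mean value inequality
applied to [y_(n+1)^k - y_n^k = 1] yields
[y_(n+1)^(-k-1) <= k (1/y_n - 1/y_(n+1))]. *)
Lemma sum_inv_root (k : nat) (y : nat -> R) n : (0 < k)%N ->
  (forall i, 0 < y i) -> (forall i, y i ^+ k = i.+1%:R) ->
  \sum_(0 <= i < n.+1) (y i)^-1 ^+ k.+1 <= 1 + k%:R * (1 - (y n)^-1).
Proof.
move=> k0 y0 yk; elim: n => [|n IHn].
  rewrite big_nat1.
  have -> : y 0%N = 1.
    by apply/eqP; rewrite -(@eqrXn2 _ k) ?(ltW (y0 _))// yk expr1n.
  by rewrite invr1 expr1n subrr mulr0 addr0.
rewrite big_nat_recr//=; apply: (le_trans (lerD IHn (lexx _))).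
set u := y n; set v := y n.+1.
have u0 : 0 < u by exact: y0. have v0 : 0 < v by exact: y0.
have uv : u <= v.
  by rewrite -(@ler_pXn2r _ k) ?nnegrE ?(ltW u0) ?(ltW v0)// /u /v !yk ler_nat.
suff h : v^-1 ^+ k.+1 <= k%:R * (u^-1 - v^-1) by rewrite !mulrBr in h *; lra.
(* From [1 <= k (v - u) v^(k-1)], divide by [v^(k+1)] and use [1 <= v / u]. *)
case: k k0 yk {IHn} => // k _ yk.
have := @subrX_le u v k; rewrite uv (ltW u0) => /(_ isT).
rewrite /u /v !yk -/u -/v -natrB// subSnn => vk.
rewrite exprVn -[leLHS]mul1r ler_pdivrMr ?exprn_gt0//.
have -> : k.+1%:R * (u^-1 - v^-1) * v ^+ k.+2 =
    (k.+1%:R * (v - u) * v ^+ k) * (v / u).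
  by rewrite !exprS; field; rewrite !gt_eqF.
rewrite -[leLHS]mulr1; apply: ler_pM => //.
by rewrite ler_pdivlMr// mul1r.
Qed.
End Weights.

(** * Neighbourhoods in the Schatten topology *)

(** The domain is abstract because on [U_ p H] the neighbourhoods unfold to the
open sets that generate them, which hides that they form a filter. *)
Lemma cvg_nbhs_dist (K : numFieldType) (V : normedModType K) (T : topologicalType)
  (f : T -> V) (g : T) :
  (forall e : K, 0 < e -> nbhs g [set h | `|f g - f h| < e]) ->
  f h @[h --> g] --> f g.
Proof. by move=> fe; apply/cvgrPdist_lt. Qed.

Section Topology.
Context {R : realType} (H : complex_hilbert R) (p : R).
Local Notation G := (schatten_unitary H p).

(** [D a g h] stands for a bound by [a] on some pseudodistance from [g] to [h]. The
triangle inequality of [D], and not that of the Schatten norm, shows that the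
[D]-balls are open. *)
Lemma nbhs_schatten_lipschitz (D : R -> G -> G -> Prop) (c : R) : 0 < c ->
  (forall g, D 0 g g) ->
  (forall a b g h k, D a g h -> D b h k -> D (a + b) g k) ->
  (forall r g h, 0 < r -> (schatten_dist g h < r%:E)%E -> D (c * r) g h) ->
  forall g e, 0 < e -> nbhs g [set h | exists2 a, a < e & D a g h].
Proof.
move=> c0 D0 DD Dc g e e0; exists [set h | exists2 a, a < e & D a g h].
split => //; last by exists 0.
move=> h [a ae Da]; exists ((e - a) / (2 * c)).
  by rewrite divr_gt0 ?mulr_gt0 ?subr_gt0.
move=> k hk; exists (a + (e - a) / 2); first by lra.
apply: (DD _ _ _ h) => //.
have -> : (e - a) / 2 = c * ((e - a) / (2 * c)) by field; rewrite gt_eqF.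
by apply: Dc => //; rewrite divr_gt0 ?mulr_gt0 ?subr_gt0.
Qed.

(** The operator norm of [g - h] is at most [a]. *)
Definition op_close (a : R) (g h : G) :=
  0 <= a /\ forall x, Num.sqrt (nsq (g x - h x)) <= a * Num.sqrt (nsq x).

Lemma nbhs_op_close (g : G) (e : R) : 0 < p -> 0 < e ->
  nbhs g [set h | exists2 a, a < e & op_close a g h].
Proof.
move=> p0; apply: (@nbhs_schatten_lipschitz _ 1) => //.
- move=> h; split=> // x; rewrite subrr mul0r.
  by rewrite /nsq /rdot linear0l/= sqrtr0.
- move=> a b g' h k [a0 ab] [b0 bc]; split=> [|x]; first exact: addr_ge0.
  rewrite mulrDl -(subrKA (h x)).
  exact: le_trans (sqrt_nsqD _ _) (lerD (ab x) (bc x)).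
- move=> r g' h r0 gh; rewrite mul1r; split=> [|x]; first exact: ltW.
  have := @schatten_norm_opnorm _ _ p r _ x p0 r0 gh => /ler_wsqrtr.
  by rewrite sqrtrM ?sqr_ge0// sqrtr_sqr gtr0_norm.
Qed.

End Topology.

(** * Reflections *)

Section Reflections.
Context {R : realType} (H : complex_hilbert R).
Context (v : H) (v1 : hdot H v v = 1).

Definition reflect_fun (x : H) : H := x - (2 * hdot H x v) *: v.

Lemma reflect_linear : linear reflect_fun.
Proof.
move=> a x y; rewrite /reflect_fun hdotDl hdotZl mulrDr scalerDl.
by rewrite scalerBr scalerA mulrCA opprD addrACA.
Qed.

Lemma reflect_dot x y : hdot H (reflect_fun x) (reflect_fun y) = hdot H x y.
Proof.
rewrite /reflect_fun hdotBl !hdotBr !hdotZl !hdotZr v1.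
rewrite (hdotC v y) rmorphM/= (_ : 2^* = 2); last exact: conjC_nat.
by ring.
Qed.

Lemma reflectK x : reflect_fun (reflect_fun x) = x.
Proof.
rewrite /reflect_fun hdotBl hdotZl v1 mulr1 -addrA -opprD -scalerDl.
by rewrite [X in X *: _](_ : _ = 0) ?scale0r ?subr0//; ring.
Qed.

Lemma reflect_surj y : exists x, reflect_fun x = y.
Proof. by exists (reflect_fun y); exact: reflectK. Qed.

Definition reflection := Unitary reflect_linear reflect_dot reflect_surj.
End Reflections.

Section SchattenReflections.
Context {R : realType} (H : complex_hilbert R) (p : R) (b : nat -> H).
Context (p0 : 0 < p) (bo : orthonormal_seq b).

Lemma orthonormal_seq1 m : hdot H (b m) (b m) = 1.
Proof. by rewrite bo eqxx. Qed.

(** The rank-one operator [x |-> - 2 <x, b m> b m]; the tail of [b] completes [b m] to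
the infinite orthonormal sequences that a Schmidt decomposition requires. *)
Lemma reflection_singular_values m :
  singular_values (fun x => reflection (orthonormal_seq1 m) x - x)
    (fun i => if i == 0%N then 2 else 0).
Proof.
split.
- by case.
- by move=> [|i] [|j].
- by apply: cvg_near_cst; exists 1%N => // -[].
- exists (fun i => b (m + i)%N), (fun i => - b (m + i)%N); split.
  + by move=> i j; rewrite bo eqn_add2l.
  + by move=> i j; rewrite hdotNN bo eqn_add2l.
  + move=> x; apply: cvg_near_cst; exists 1%N => // -[//|n] _.
    rewrite big_ltn// [X in _ + X]big_nat [X in _ + X]big1 ?addr0
      => [|[//|i] _]; last first.
      by rewrite rmorph0 mul0r scale0r.
    rewrite addn0 /= /reflect_fun addrAC subrr add0r scalerN.
    by rewrite (_ : 2%:C%C = 2) // rmorph_nat.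
Qed.

Lemma reflection_schatten m :
  schatten_ideal p (fun x => reflection (orthonormal_seq1 m) x - x).
Proof.
apply: (@le_lt_trans _ _
  ((\sum_(0 <= n <oo) ((if n == 0%N then 2 : R else 0) `^ p)%:E) `^ p^-1)%E).
  by apply: ereal_inf_lbound; eexists; [exact: reflection_singular_values|].
apply: poweR_lty; apply: (@le_lt_trans _ _ (2 `^ p)%:E); last exact: ltey.
apply: lime_le.
  by apply: is_cvg_nneseries => n _ _; rewrite lee_fin powR_ge0.
apply: nearW => -[|n]; first by rewrite big_nil lee_fin powR_ge0.
rewrite big_ltn// [X in (_ + X)%E]big_nat [X in (_ + X)%E]big1 ?adde0//.
by move=> [//|i] _; rewrite powR0 ?gt_eqF.
Qed.

Definition schatten_reflection m : schatten_unitary H p :=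
  SchattenUnitary (reflection_schatten m).

End SchattenReflections.

(** * Two continuous representations *)

Section Representations.
Context {R : realType} (H : complex_hilbert R) (p : R).
Local Notation G := (U_ p H).
Local Notation V := (hsum_hilbert H).

Lemma schatten_near_one (g : schatten_unitary H p) :
  exists2 r : R, 0 < r & (schatten_norm p (fun x : H => (g x - x)%R) < r%:E)%E.
Proof.
have := schatten_unitaryP g; rewrite /schatten_ideal /=.
case: (schatten_norm _ _) => [x _|//|_]; last by exists 1; rewrite ?ltNye.
exists (Num.max x 0 + 1); first by rewrite ltr_wpDl// le_max lexx orbT.
by rewrite lte_fin ltr_pwDr// le_max lexx.
Qed.

Definition natural_rep (g : G) : unitary H := g.

Lemma natural_rep_continuous : 0 < p -> continuous_representation natural_rep.
Proof.
move=> p0; split=> // v g; apply: cvg_nbhs_dist => e e0.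
have [r er] : exists r : R, e = r%:C%C.
  by exists (complex.Re e); rewrite RRe_real ?gtr0_real.
subst e; rewrite ltcR in e0.
have vp : 0 < Num.sqrt (nsq v) + 1 by rewrite ltr_wpDl ?sqrtr_ge0.
have d0 : 0 < r / (Num.sqrt (nsq v) + 1) by rewrite divr_gt0.
apply: filterS (nbhs_op_close g p0 d0) => h [a ae [a0 gh]].
suff : `|natural_rep g v - natural_rep h v| < r%:C%C by [].
rewrite hilbert_normE ltcR; apply: le_lt_trans (gh v) _.
rewrite ltr_pdivlMr// in ae; apply: le_lt_trans ae.
by rewrite ler_wpM2l// lerDl.
Qed.

Definition amplified_rep (g : G) : unitary V := amplify g.

Lemma amplified_rep_continuous : 0 < p -> continuous_representation amplified_rep.
Proof.
move=> p0; split=> [g h gh gE|v g].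
  by rewrite /amplified_rep -amplifyM; congr amplify; exact: gE.
apply: cvg_nbhs_dist => e e0.
have d0 : 0 < e / (hsum_norm v + 1).
  by rewrite divr_gt0// ltr_wpDl ?hsum_norm_ge0.
apply: filterS (nbhs_op_close g p0 d0) => h [a ae [a0 gh]].
have vp : 0 < hsum_norm v + 1 by rewrite ltr_wpDl ?hsum_norm_ge0.
suff : hsum_norm (amplify_fun g v - amplify_fun h v) < e by [].
apply: (@le_lt_trans _ _ (a * hsum_norm v)); last first.
  rewrite ltr_pdivlMr// in ae; apply: le_lt_trans ae.
  by rewrite ler_wpM2l// lerDl.
rewrite -(@ler_pXn2r _ 2) ?nnegrE ?mulr_ge0 ?hsum_norm_ge0// exprMn !hsum_norm_sqr.
apply: hsum_dot_le => n.
apply: le_trans (_ : a ^+ 2 * \sum_(0 <= i < n) nsq (v i) <= _); last first.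
  by rewrite ler_wpM2l ?sqr_ge0// hsum_dot_ge.
rewrite mulr_sumr; apply: ler_sum => i _.
rewrite -[leLHS]sqr_sqrtr ?nsq_ge0// -[nsq (v i)]sqr_sqrtr ?nsq_ge0// -exprMn.
by rewrite lerXn2r ?nnegrE ?mulr_ge0 ?sqrtr_ge0//; exact: gh.
Qed.

End Representations.

(** * The harmonic cocycle and almost fixed vectors *)

Section Cocycle.
Context {R : realType} (H : complex_hilbert R) (p : R) (b : nat -> H).
Context (p0 : 0 < p) (bo : orthonormal_seq b).
Local Notation G := (U_ p H).
Local Notation V := (hsum_hilbert H).

(** The diagonal operator with entries [(j+1)^(-1/2)] lies in all Schatten classes of
exponent above 2, so that Hoelder's inequality holds for every finite [p]. The
weights are [1/(j+1) = (1/y j)^k] with [k > p], and the [(k+1)]-st powers of the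
[1/y j] are summable. *)
Lemma schatten_norm_harmonic : exists2 c : R, 0 < c & forall T r N, 0 < r ->
  (schatten_norm p T < r%:E)%E ->
  \sum_(0 <= j < N) j.+1%:R^-1 * nsq (T (b j)) <= c * r ^+ 2.
Proof.
pose k := (Num.truncn p).+1.
have k0 : (0 < k)%N by [].
have pk : p <= 2 * k.+1%:R.
  have /ltW/le_trans : p < k%:R by exact: truncnS_gt.
  apply; rewrite -natrM ler_nat; exact: leq_trans (leqnSn k) (leq_pmull _ _).
pose y (i : nat) : R := i.+1%:R `^ k%:R^-1.
have y0 i : 0 < y i by rewrite powR_gt0.
have yk i : y i ^+ k = i.+1%:R.
  by rewrite -powR_mulrn ?ltW// -powRrM mulVf ?powRr1 ?pnatr_eq0.
exists (1 + (1 + k%:R)); first by rewrite addr_gt0 ?addr_gt0 ?ltr0n.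
move=> T r N r0 Tr.
under eq_bigr => j _ do rewrite -yk -exprVn.
apply: (schatten_norm_weighted N p0 pk r0 bo) => // [i|n]; first by rewrite invr_gt0.
have -> : (1 + k%:R : R) = 1 + k%:R * 1 by rewrite mulr1.
case: n => [|n]; first by rewrite big_nil addr_ge0.
apply: le_trans (sum_inv_root n k0 y0 yk) _.
by rewrite lerD2l ler_wpM2l// gerBl invr_ge0 ltW.
Qed.

Definition sqrt_harmonic (n : nat) : R := Num.sqrt n.+1%:R^-1.

Lemma nsq_sqrt_harmonic n (x : H) :
  nsq ((sqrt_harmonic n)%:C%C *: x) = n.+1%:R^-1 * nsq x.
Proof. by rewrite nsqZ normsqR sqr_sqrtr ?invr_ge0. Qed.

Lemma harmonic_cocycle_subproof (g : schatten_unitary H p) :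
  (fun n => (sqrt_harmonic n)%:C%C *: (g (b n) - b n)) \in @hsummable R H.
Proof.
have [r r0 gr] := schatten_near_one g; have [c c0 cP] := schatten_norm_harmonic.
apply: (@hsummable_bound _ _ _ (c * r ^+ 2)) => N.
under eq_bigr do rewrite nsq_sqrt_harmonic.
exact: (cP _ _ N r0 gr).
Qed.

(** This is [(g - 1) A] for the diagonal operator [A] with entries
[sqrt_harmonic n]. *)
Definition harmonic_cocycle (g : G) : V := Hsum (harmonic_cocycle_subproof g).

Lemma harmonic_cocycleP : cocycle (@amplified_rep R H p) harmonic_cocycle.
Proof.
move=> g h gh /(congr1 (@unitary_fun _ _ _)) => ghE; apply: hsum_ext => n.
rewrite hsumDE /= ghE /= unitaryZ -scalerDr unitaryB; congr (_ *: _).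
by rewrite [RHS]addrC subrKA.
Qed.

(** The difference of the values at [g] and [h] is [(g - h) A], so Hoelder's
inequality makes the cocycle Lipschitz. *)
Lemma harmonic_cocycle_continuous : continuous harmonic_cocycle.
Proof.
have [c c0 cP] := schatten_norm_harmonic.
move=> g; apply: cvg_nbhs_dist => e e0.
pose D (a : R) (g h : schatten_unitary H p) :=
  hsum_norm (harmonic_cocycle g - harmonic_cocycle h) <= a.
have sc0 : 0 < Num.sqrt c by rewrite sqrtr_gt0.
apply: filterS (@nbhs_schatten_lipschitz _ _ _ D _ sc0 _ _ _ g e e0).
- by move=> h [a ae /le_lt_trans]; apply.
- by move=> h; rewrite /D subrr -[hsum_norm 0]/`|0 : hsum H| normr0.
- move=> a a' g' h k ab bc; rewrite /D -(subrKA (harmonic_cocycle h)).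
  exact: le_trans (hsum_normD _ _) (lerD ab bc).
- move=> r g' h r0 gh; rewrite /D.
  rewrite -(@ler_pXn2r _ 2) ?nnegrE ?mulr_ge0 ?hsum_norm_ge0 ?sqrtr_ge0 ?(ltW r0)//.
  rewrite exprMn hsum_norm_sqr sqr_sqrtr ?(ltW c0)//.
  apply: hsum_dot_le => n; apply: le_trans (cP _ _ n r0 gh).
  apply: ler_sum => i _; rewrite -nsq_sqrt_harmonic.
  by rewrite hsumDE hsumNE /= -scalerBr opprB addrA subrK.
Qed.

(** The [m]-th coordinate of the coboundary equation, for the reflection in [b m],
forces [<v m, b m> = (m+1)^(-1/2)], hence [nsq (v m) >= 1/(m+1)]: the sequence
[v] cannot be square-summable. *)
Lemma harmonic_cocycle_not_coboundary :
  ~ coboundary (@amplified_rep R H p) harmonic_cocycle.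
Proof.
move=> [v vP]; apply: (@dvg_harmonic R); apply: nondecreasing_is_cvgn.
  by apply: nondecreasing_series => i _ _; rewrite /= invr_ge0.
exists (hsum_dot v v) => _ [n _ <-].
apply: le_trans (hsum_dot_ge v n); rewrite /series /=; apply: ler_sum => m _.
have /(congr1 (fun f : hsum H => f m)) := vP (schatten_reflection p0 bo m).
rewrite hsumDE hsumNE /= /reflect_fun orthonormal_seq1// mulr1.
have subAC (x y : H) : x - y - x = - y by rewrite addrAC subrr add0r.
rewrite !subAC scalerN scalerA => /oppr_inj.
move/(congr1 (hdot H ^~ (b m))); rewrite !hdotZl orthonormal_seq1// !mulr1 mulrC.
move/(mulfI (_ : (2 : R[i]) != 0)); rewrite pnatr_eq0 => /(_ isT) vm.
have := bessel (v m) m.+1 bo; rewrite big_nat_recr//= -vm normsqR sqr_sqrtr ?invr_ge0//.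
apply: le_trans; rewrite lerDr sumr_ge0// => i _; exact: normsq_ge0.
Qed.

Lemma not_property_FH : ~ property_FH G R.
Proof.
move=> FH; apply: harmonic_cocycle_not_coboundary.
exact: FH (@amplified_rep_continuous R H p p0) _
  harmonic_cocycle_continuous harmonic_cocycleP.
Qed.

(** Otherwise pick, for each [n], some [g n] in [K] moving [b n] by more than [e]. At
a cluster point [q], infinitely many [g n] are close to [q] in operator norm,
while [q] almost fixes [b n] for large [n]. *)
Lemma compact_almost_fixed (K : set G) (e : R) : compact K -> 0 < e ->
  exists n, forall g, K g -> Num.sqrt (nsq (natural_rep g (b n) - b n)) <= e.
Proof.
move=> cK e0; apply: contrapT => /forallNP no.
have /choice[g gP] n : exists g, K g /\ e < Num.sqrt (nsq (natural_rep g (b n) - b n)).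
  by have /existsNP[g /not_implyP[Kg /negP]] := no n; rewrite -ltNge; exists g.
have gK : (g @ \oo) K by exists 0%N => // n _; exact: (gP n).1.
have [q [Kq qc]] := cK (g @ \oo) _ gK.
have e20 : 0 < e / 2 by rewrite divr_gt0.
have [r r0 qr] := schatten_near_one q.
have /cvgr_lt/(_ ((e / 2) ^+ 2)) := schatten_norm_orthonormal_cvg0 p0 r0 bo qr.
move=> /(_ (exprn_gt0 _ e20))[N _ qN].
have gN : (g @ \oo) [set g n | n in [set n | (N <= n)%N]].
  by exists N => // n Nn; exists n.
have [_ [[n /= Nn <-] [a ae [_ qg]]]] := qc _ _ gN (nbhs_op_close q p0 e20).
have := (gP n).2; rewrite ltNge => /negP; apply.
rewrite -(subrKA (q (b n))); apply: le_trans (sqrt_nsqD _ _) _.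
rewrite (splitr e); apply: lerD.
  rewrite nsqBC; apply: le_trans (qg (b n)) _.
  by rewrite {1}/nsq /rdot orthonormal_seq1//= sqrtr1 mulr1 ltW.
have := qN n Nn; rewrite /= -[X in _ < X -> _]ger0_norm ?sqr_ge0//.
by move=> /ltW/ler_wsqrtr; rewrite ger0_norm ?sqr_ge0// sqrtr_sqr gtr0_norm.
Qed.

Lemma not_property_T : (forall w, (forall m, hdot H w (b m) = 0) -> w = 0) ->
  ~ property_T G R.
Proof.
move=> btot [K [e [cK e0 KT]]]; have e20 : 0 < e / 2 by rewrite divr_gt0.
have [n nP] := compact_almost_fixed cK e20.
have [|w w0 wfix] := KT H _ (@natural_rep_continuous R H p p0).
- exists (b n); first by rewrite hilbert_normE /nsq /rdot orthonormal_seq1// sqrtr1.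
  apply: (@le_lt_trans _ _ (e / 2)%:E); last by rewrite lte_fin; lra.
  by apply: ub_ereal_sup => _ [g Kg <-]; rewrite hilbert_normE lee_fin nP.
- move/eqP : w0; apply; apply: btot => m.
  have /eqP := wfix (schatten_reflection p0 bo m).
  rewrite /= /reflect_fun -subr_eq0 addrAC subrr add0r oppr_eq0 scaler_eq0.
  move=> /orP[|/eqP bm]; first by rewrite mulf_eq0 pnatr_eq0 => /eqP.
  by rewrite bm /hdot linear0r.
Qed.

End Cocycle.

(** * The standard basis of the sequence space *)

Section StandardBasis.
Context {R : realType}.

Lemma series_delta_cvg (u : nat -> R) m : (forall n, n != m -> u n = 0) ->
  series u @ \oo --> u m.
Proof.
move=> um; apply: cvg_near_cst; exists m.+1 => // n /= mn.
rewrite /series /= (bigD1_seq m) ?iota_uniq ?mem_index_iota//= big1 ?addr0//.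
Qed.

Definition delta_seq (m n : nat) : R[i] := (n == m)%:R.

Lemma delta_square_summable m : delta_seq m \in square_summable.
Proof.
apply/square_summableP/cvg_ex; exists (normsq (delta_seq m m)).
apply: (@series_delta_cvg (fun n => normsq (delta_seq m n))) => n /negPf nm.
by rewrite /delta_seq nm /normsq /= expr0n addr0.
Qed.

Definition std_basis m : ell2 R := Ell2 (delta_square_summable m).

Lemma hdot_std_basis (f : ell2 R) m :
  hdot (ell2_hilbert R) f (std_basis m) = f m.
Proof.
have off n : n != m -> f n * (delta_seq m n)^* = 0.
  by move=> /negPf nm; rewrite /delta_seq nm conjC0 mulr0.
have on : f m * (delta_seq m m)^* = f m.
  by rewrite /delta_seq eqxx conjC1 mulr1.
have reim : Complex (complex.Re (f m)) (complex.Im (f m)) = f m by case: (f m).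
rewrite -[LHS]/(Complex _ _) -[RHS]reim.
congr Complex; apply: cvg_lim => //.
- rewrite -[in X in _ --> X]on.
  apply: (@series_delta_cvg (fun n => complex.Re (f n * (delta_seq m n)^*))).
  by move=> n /off ->.
- rewrite -[in X in _ --> X]on.
  apply: (@series_delta_cvg (fun n => complex.Im (f n * (delta_seq m n)^*))).
  by move=> n /off ->.
Qed.

Lemma std_basis_orthonormal : orthonormal_seq (std_basis : nat -> ell2_hilbert R).
Proof. by move=> m n; rewrite hdot_std_basis /= /delta_seq eq_sym. Qed.

Lemma std_basis_total (f : ell2_hilbert R) :
  (forall m, hdot (ell2_hilbert R) f (std_basis m) = 0) -> f = 0.
Proof.
by move=> f0; apply/val_inj/funext => m; have := f0 m; rewrite hdot_std_basis.
Qed.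

End StandardBasis.

(** * Failure of both properties *)

Theorem corollary7p10 (R : realType) (p : R) (hp : 1 <= p) :
  ~ property_FH (U_ p (ell2_hilbert R)) R /\
  ~ property_T (U_ p (ell2_hilbert R)) R.
Proof.
have p0 : 0 < p := lt_le_trans ltr01 hp.
split; first exact: not_property_FH p0 std_basis_orthonormal.
exact: not_property_T p0 std_basis_orthonormal std_basis_total.
Qed.
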